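(* Let $w\in\mathcal{I}(\mathfrak{S}^B_n)$ be an involution in the group of signed permutations $\mathfrak{S}^B_n$. Then $w$ is Boolean if and only if it avoids all of the following signed patterns (written in window notation, where $\underline{i}$ stands for $-i$): $$4321,\quad \underline{1}\,\underline{2},\quad 2\,1\,\underline{3},\quad 3\,\underline{4}\,1\,\underline{2},\quad \underline{4}\,3\,2\,\underline{1},$$ $$45312,\quad 1\,\underline{3}\,\underline{2},\quad 4\,2\,\underline{3}\,1,\quad \underline{4}\,5\,3\,\underline{1}\,2,\quad 5\,\underline{4}\,3\,\underline{2}\,1,$$ $$456123,\quad \underline{3}\,\underline{2}\,\underline{1},\quad 4\,\underline{3}\,\underline{2}\,1,\quad 4\,5\,\underline{3}\,1\,2,\quad \underline{4}\,5\,6\,\underline{1}\,2\,3,\quad 5\,\underline{4}\,6\,\underline{2}\,1\,3.$$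
   Context: $\mathfrak{S}^B_n$ is the group of permutations $\pi$ of $[\pm n]=\{-n,\dots,-1,1,\dots,n\}$ with $\pi(i)=-\pi(-i)$ for all $i\in[n]$. It is a Coxeter group with Coxeter generators $\mathfrak{s}^B_0=(1,-1)$ and $\mathfrak{s}^B_i=(i,i+1)(-i,-i-1)$ for $i\in[n-1]$. Its Bruhat order is the (strong) Bruhat order with respect to these generators. $\mathcal{I}(\mathfrak{S}^B_n)$ is the set of involutions (elements of order at most two, including the identity). For $w\in\mathcal{I}(\mathfrak{S}^B_n)$, let $B(w)=\{u\in\mathcal{I}(\mathfrak{S}^B_n):u\le w\}$ with the order induced from the Bruhat order on $\mathfrak{S}^B_n$; $w$ is Boolean if $B(w)$ is isomorphic to a Boolean lattice. Window notation: $\pi\in\mathfrak{S}^B_n$ is represented by the sequence $\pi(1)\cdots\pi(n)$. Given $\pi\in\mathfrak{S}^B_n$ and $p\in\mathfrak{S}^B_m$ with $m\le n$, $\pi$ contains the signed pattern $p$ if there exist $1\le i_1<\cdots<i_m\le n$ such that for all $j,k\in[m]$ one has $|\pi(i_j)|<|\pi(i_k)|$ iff $|p(j)|<|p(k)|$, and $\mathrm{sgn}(\pi(i_j))=\mathrm{sgn}(p(j))$ for all $j\in[m]$. Otherwise $\pi$ avoids $p$ (in particular if $m>n$). *)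

(* Defs.v *)
From mathcomp Require Import all_boot all_order all_fingroup all_algebra.
Set Implicit Arguments.
Unset Strict Implicit.
Unset Printing Implicit Defensive.
Local Open Scope group_scope.

(* Bruhat order of a Coxeter system (<<S>>, S) inside a finite group.         *)

(* [S ^+ k] is the setwise power, i.e. the set of all products of k elements  *)
(* of S.  An element of <<S>> has length < #|gT| (its distance to 1 in the    *)
(* Cayley graph, since the elements of S are involutions), so the search      *)
(* below always succeeds on <<S>>.                                            *)
Definition cox_length (gT : finGroupType) (S : {set gT}) (w : gT) : nat :=
  find (fun k => w \in S ^+ k) (iota 0 #|gT|).

(* [class_support S <<S>>] is the set of all conjugates x ^ y with x in S and *)
(* y in <<S>>. *)
Definition reflections (gT : finGroupType) (S : {set gT}) : {set gT} :=
  class_support S <<S>>.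

Definition bruhat_step (gT : finGroupType) (S : {set gT}) : rel gT :=
  fun u v => (cox_length S u < cox_length S v)%N
             && [exists t in reflections S, v == u * t].

Definition bruhat_le (gT : finGroupType) (S : {set gT}) : rel gT :=
  connect (bruhat_step S).

(* The set [±n]: (false, i) stands for i + 1 and (true, i) for - (i + 1).     *)
Definition pm (n : nat) : finType := (bool * 'I_n)%type.

Definition pm_pos n (i : 'I_n) : pm n := (false, i).

Definition pm_opp n (x : pm n) : pm n := (~~ x.1, x.2).

Definition pm_int n (x : pm n) : int :=
  (if x.1 then - (x.2.+1)%:Z else (x.2.+1)%:Z)%R.

Definition signed_perms n : {set {perm pm n}} :=
  [set w : {perm pm n} |
    [forall i : 'I_n, w (pm_pos i) == pm_opp (w (pm_opp (pm_pos i)))]].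

(* The generator (1, -1); it is absent when n = 0. *)
Definition gens0 n : {set {perm pm n}} :=
  [set tperm (pm_pos i) (pm_opp (pm_pos i)) | i : 'I_n & i == 0 :> nat].

(* (i, j)(-i, -j) *)
Definition swapA n (i j : 'I_n) : {perm pm n} :=
  tperm (pm_pos i) (pm_pos j) *
  tperm (pm_opp (pm_pos i)) (pm_opp (pm_pos j)).

Definition gensA n : {set {perm pm n}} :=
  [set swapA ij.1 ij.2 | ij : 'I_n * 'I_n & ij.2 == ij.1.+1 :> nat].

Definition gensB n : {set {perm pm n}} := gens0 n :|: gensA n.

Definition leB n : rel {perm pm n} := bruhat_le (gensB n).

Definition invol_signed n : {set {perm pm n}} :=
  [set w in signed_perms n | (#[w] <= 2)%N].

Definition invol_ideal n (w : {perm pm n}) : {set {perm pm n}} :=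
  [set u in invol_signed n | leB u w].

(* The lattice of all subsets of a k-element set, for some k. *)
Definition boolean_invol n (w : {perm pm n}) : Prop :=
  exists (k : nat) (f : {u | u \in invol_ideal w} -> {set 'I_k}),
    bijective f
    /\ forall u v, (f u \subset f v) = leB (val u) (val v).

Definition window n (w : {perm pm n}) (i : 'I_n) : int := pm_int (w (pm_pos i)).

(* A signed pattern is given by its window p(1), ..., p(m), as a sequence of  *)
(* integers. *)
Definition contains n (w : {perm pm n}) (p : seq int) : Prop :=
  exists f : 'I_(size p) -> 'I_n,
    [/\ {homo f : j k / (j < k)%N},
        forall j k, (`|window w (f j)| < `|window w (f k)|)%N
                    = (`|nth 0%R p j| < `|nth 0%R p k|)%N
      & forall j, sgz (window w (f j)) = sgz (nth 0%R p j)].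

Definition avoids n (w : {perm pm n}) (p : seq int) : Prop := ~ contains w p.

(* Main.v *)
(* View a signed involution [w] as an involution of [±n], drawn as a set of arcs
   [x < w x]. The ideal of [w] is Boolean iff [w] is "tight": no arc is nested
   in another, and two crossing arcs [x < y < w x < w y] have no point between
   [y] and [w x].
   Let [s] be a descent of [w], and let [w'] be [w * s] if [s] and [w] commute
   and [s * w * s] otherwise. By the lifting property the ideal of [w] consists
   of the ideal of [w'] and its image under the same operation, so it is Boolean
   as soon as that of [w'] is and [s] is not below [w']; conversely, if [s] is
   below [w'] then [w] and [w'] have the same generators below them, which
   cannot happen in a Boolean lattice. A generator exchanging two adjacent
   points is below [u] iff an arc of [u] crosses the gap between them, and [w]
   is tight iff [w'] is tight and none of its arcs crosses the gap of [s]. The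
   equivalence follows by induction on the length.
   The sixteen patterns are the signed traces of the patterns 4321, 45312 and
   456123 in the permutation of [±n]; the first one forces a nesting, the other
   two a crossing with a point in between. *)
Require Import Defs.
From mathcomp Require Import all_boot all_order all_fingroup all_algebra.
From mathcomp Require Import cyclic zify.
Set Implicit Arguments.
Unset Strict Implicit.
Unset Printing Implicit Defensive.

Ltac split_ifs := repeat match goal with |- context [if ?b then _ else _] =>
  lazymatch b with context [if _ then _ else _] => fail
  | _ => case: (boolP b) => ? end end.

(** * Signed reflections and the Coxeter generators *)

Section SignedReflections.
Import Order.TTheory GRing.Theory Num.Theory GroupScope.
Local Open Scope ring_scope.
Local Open Scope group_scope.
Local Notation v := (@pm_int _).
Variable n : nat.
Implicit Types (x y z p q a b : pm n) (u w s t : {perm pm n}).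

Lemma pm_int_inj : injective (@pm_int n).
Proof.
case=> [b i] [c j]; rewrite /pm_int /= => h.
have e : b = c by case: b c h => [] [] //=; lia.
by rewrite e; congr (_, _); apply: val_inj => /=; move: h; rewrite e; case: c {e}; lia.
Qed.

Lemma pm_int_opp x : v (pm_opp x) = (- v x)%R.
Proof. by case: x => [[] i]; rewrite /pm_int /pm_opp /= ?opprK. Qed.

Lemma pm_int_neq0 x : v x != 0%R.
Proof. by case: x => [[] i]; rewrite /pm_int /=; lia. Qed.

Lemma pm_oppK : involutive (@pm_opp n).
Proof. by case=> b i; rewrite /pm_opp /= negbK. Qed.

Lemma pm_opp_neq x : pm_opp x != x.
Proof.
by apply/eqP=> /(congr1 v); rewrite pm_int_opp; have := pm_int_neq0 x; lia.
Qed.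

Lemma signedP w : w \in signed_perms n <-> {morph w : x / pm_opp x}.
Proof.
rewrite inE; split=> [/forallP h [b i]|h].
  have /eqP := h i; rewrite /pm_pos /pm_opp /= => e.
  by case: b => /=; rewrite ?e /= ?negbK; case: (w (true, i)) => c j.
by apply/forallP=> i; rewrite h pm_oppK.
Qed.

Lemma signed_opp w : w \in signed_perms n -> {morph w : x / pm_opp x}.
Proof. by move/signedP. Qed.

Lemma group_set_signed : group_set (signed_perms n).
Proof.
apply/group_setP; split=> [|u w /signedP hu /signedP hw].
  by apply/signedP=> x; rewrite !perm1.
by apply/signedP=> x; rewrite !permM hu hw.
Qed.
Canonical signed_group := Group group_set_signed.

(** When [q] is the opposite of [p] the two transpositions coincide and their product would be
    trivial, hence the separate case. *)
Definition refl p q : {perm pm n} :=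
  if q == pm_opp p then tperm p q
  else tperm p q * tperm (pm_opp p) (pm_opp q).

Lemma reflE p q x : refl p q x =
  if x == p then q else if x == q then p else
  if x == pm_opp p then pm_opp q else if x == pm_opp q then pm_opp p else x.
Proof.
have e1 : (pm_opp p == p) = false by apply/negbTE/pm_opp_neq.
have e2 : (pm_opp q == q) = false by apply/negbTE/pm_opp_neq.
rewrite /refl; case: eqVneq => [->|h].
  by rewrite pm_oppK permE /=; do !case: eqP => // _.
have e3 : (p == pm_opp q) = false by apply/negbTE; rewrite eq_sym (can2_eq pm_oppK pm_oppK).
have e4 : (q == pm_opp p) = false by apply/negbTE.
rewrite permM; case: (eqVneq x p) => [->|h1].
  by rewrite tpermL tpermD ?e2 // eq_sym e4.
case: (eqVneq x q) => [->|h2]; first by rewrite tpermR tpermD ?e1 // eq_sym e3.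
by rewrite [tperm p q x]tpermD 1?[_ == x]eq_sym ?permE.
Qed.

Lemma reflL p q : refl p q p = q.
Proof. by rewrite reflE eqxx. Qed.

Lemma reflR p q : refl p q q = p.
Proof. by rewrite reflE eqxx; case: eqP. Qed.

Lemma pm_eq_v x y : (x == y) = (v x == v y).
Proof. by rewrite (inj_eq pm_int_inj). Qed.

(** Passing to integer values turns identities between reflections into case splits for [lia]. *)
Lemma reflEv p q x : v (refl p q x) =
  if v x == v p then v q else if v x == v q then v p else
  if (v x == - v p) then - v q else if (v x == - v q) then - v p else v x.
Proof.
by rewrite reflE !pm_eq_v !pm_int_opp; repeat case: ifP => _ //; rewrite pm_int_opp.
Qed.

Lemma refl_signed p q : refl p q \in signed_perms n.
Proof.
apply/signedP=> x; apply: pm_int_inj; rewrite pm_int_opp !reflEv pm_int_opp.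
by have := pm_int_neq0 x; have := pm_int_neq0 p; have := pm_int_neq0 q; split_ifs; lia.
Qed.

Lemma refl_opp p q : refl (pm_opp p) (pm_opp q) = refl p q.
Proof.
apply/permP=> x; apply: pm_int_inj; rewrite !reflEv !pm_int_opp.
by have := pm_int_neq0 p; have := pm_int_neq0 q; split_ifs; lia.
Qed.

Lemma reflC p q : refl p q = refl q p.
Proof. by apply/permP=> x; apply: pm_int_inj; rewrite !reflEv; split_ifs; lia. Qed.

Lemma reflJ p q w : w \in signed_perms n -> refl p q ^ w = refl (w p) (w q).
Proof.
move=> hw; rewrite /refl -(signed_opp hw) (inj_eq perm_inj).
by case: ifP => _; rewrite ?conjMg !tpermJ ?(signed_opp hw).
Qed.

Lemma reflK p q : refl p q * refl p q = 1.
Proof.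
apply/permP=> x; rewrite permM perm1; apply: pm_int_inj; rewrite !reflEv.
by have := pm_int_neq0 p; have := pm_int_neq0 q; split_ifs; lia.
Qed.

(** A reflection is recovered from any one point that it moves, so equality of reflections becomes a
    one-point check. *)
Lemma refl_moved p q x : refl p q x != x -> refl p q = refl x (refl p q x).
Proof.
rewrite [refl p q x]reflE => h.
case: (eqVneq x p) h => [->|_] // h.
case: (eqVneq x q) h => [->|_] h; first by rewrite reflC.
case: (eqVneq x (pm_opp p)) h => [->|_] h; first by rewrite refl_opp.
case: (eqVneq x (pm_opp q)) h => [->|_]; first by rewrite refl_opp reflC.
by rewrite eqxx.
Qed.

(** Since 0 is absent from [±n], the points -1 and 1 are adjacent; every generator then exchanges an
    adjacent pair and the opposite pair, with no special case for index 0. *)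
Definition adjacent p q : Prop :=
  v p < v q /\ forall z, v z <= v p \/ v q <= v z.

Definition simple s : Prop := exists p q, adjacent p q /\ s = refl p q.

Lemma adjacent_opp p q : adjacent p q -> adjacent (pm_opp q) (pm_opp p).
Proof.
move=> [h1 h2]; split=> [|z]; rewrite !pm_int_opp; first lia.
have := h2 (pm_opp z); rewrite pm_int_opp. lia.
Qed.

(** Only neighbours are exchanged, so no pair other than an exchanged one can be reversed. *)
Lemma adjacent_mono p q x y : adjacent p q -> v x < v y -> refl p q x != y ->
  v (refl p q x) < v (refl p q y).
Proof.
move=> [h1 h2] h; rewrite pm_eq_v !reflEv.
have := h2 x; have := h2 y; have := h2 (pm_opp x); have := h2 (pm_opp y).
have := h2 (pm_opp p); have := h2 (pm_opp q); have := pm_int_neq0 p; have := pm_int_neq0 q.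
rewrite !pm_int_opp; split_ifs; lia.
Qed.

Lemma simple_mono s x y : simple s -> v x < v y -> s x != y -> v (s x) < v (s y).
Proof. by move=> [p [q [h ->]]]; apply: adjacent_mono. Qed.

Lemma refl_up p q x : v p < v q -> v x < v (refl p q x) ->
  x = p \/ x = pm_opp q.
Proof.
move=> h1 h.
have : x == p \/ x == pm_opp q.
  by move: h; rewrite !pm_eq_v pm_int_opp reflEv; split_ifs; lia.
by case=> /eqP; [left | right].
Qed.

Lemma swapA_refl (i j : 'I_n) : swapA i j = refl (pm_pos i) (pm_pos j).
Proof. by rewrite /refl; case: eqP. Qed.

Lemma simpleP s : simple s <-> s \in gensB n.
Proof.
split=> [[p [q [[]]]]|].
  case: p q => [b i] [c j]; rewrite /pm_int /=.
  (* By signs: two negative points, the pair -1 and 1, an impossible case, two positive points.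
     Adjacency, tested next to the point nearer to zero or at -1 and 1, pins down the indices. *)
  case: b c => [] [] /= h hz ->.
  - have e : i = j.+1 :> nat.
      have lt : (j.+1 < n)%N by have := ltn_ord i; lia.
      by have := hz (true, Ordinal lt); rewrite /pm_int /=; lia.
    rewrite inE; apply/orP; right; apply/imsetP; exists (j, i); first by rewrite inE e.
    by rewrite swapA_refl -refl_opp reflC.
  - have e0 : i = 0 :> nat.
      have := hz (true, Ordinal (leq_ltn_trans (leq0n i) (ltn_ord i))).
      by have := hz (false, i); rewrite /pm_int /=; lia.
    have e1 : j = i.
      apply/val_inj => /=.
      have := hz (false, Ordinal (leq_ltn_trans (leq0n i) (ltn_ord i))).
      by have := hz (false, i); rewrite /pm_int /=; lia.
    rewrite inE; apply/orP; left; apply/imsetP; exists i; first by rewrite inE e0.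
    by rewrite e1 reflC /refl /pm_opp /pm_pos eqxx.
  - by lia.
  - have e : j = i.+1 :> nat.
      have lt : (i.+1 < n)%N by have := ltn_ord j; lia.
      by have := hz (false, Ordinal lt); rewrite /pm_int /=; lia.
    rewrite inE; apply/orP; right; apply/imsetP; exists (i, j); first by rewrite inE e.
    by rewrite swapA_refl.
rewrite inE => /orP[] /imsetP.
  move=> [i]; rewrite inE => /eqP i0 ->.
  exists (pm_opp (pm_pos i)), (pm_pos i); split; last by rewrite reflC /refl eqxx.
  split; first by rewrite pm_int_opp /pm_int /=; lia.
  by rewrite pm_int_opp; case=> [[] k]; rewrite /pm_int /=; lia.
move=> [[i j]]; rewrite inE /= => /eqP e ->.
exists (pm_pos i), (pm_pos j); split; last exact: swapA_refl.
split; first by rewrite /pm_int /=; lia.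
by case=> [[] k]; rewrite /pm_int /=; lia.
Qed.

End SignedReflections.

(** * Lengths and inversions *)

Section BruhatB.
Import Order.TTheory GRing.Theory Num.Theory GroupScope.
Local Open Scope ring_scope.
Local Open Scope group_scope.
Local Notation v := (@pm_int _).
Variable n : nat.
Implicit Types (x y z p q a b : pm n) (u w s t : {perm pm n}).
Local Notation S := (gensB n).
Local Notation T := (reflections S).
Local Notation len := (cox_length S).

Lemma simple_signed s : simple s -> s \in signed_perms n.
Proof. by case=> p [q [_ ->]]; apply: refl_signed. Qed.

Lemma gen_sub_signed : <<S>> \subset signed_group n.
Proof. by rewrite gen_subG; apply/subsetP=> s /simpleP; apply: simple_signed. Qed.

Lemma gen_signed w : w \in <<S>> -> w \in signed_perms n.
Proof. exact/subsetP/gen_sub_signed. Qed.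

Lemma simple_gen s : simple s -> s \in <<S>>.
Proof. by move/simpleP; apply: mem_gen. Qed.

Lemma simple_reflection s : simple s -> s \in T.
Proof.
move/simpleP => hs; apply/imset2P; exists s (1 : {perm pm n}) => //; last by rewrite conjg1.
Qed.

Lemma reflectionP t : t \in T -> exists p q, v p < v q /\ t = refl p q.
Proof.
case/imset2P=> s g /simpleP[p [q [[h _] ->]]] hg ->.
rewrite reflJ ?gen_signed //.
have ne : v (g p) != v (g q).
  by rewrite (inj_eq (@pm_int_inj n)) (inj_eq perm_inj) pm_eq_v; lia.
have [|] : v (g p) < v (g q) \/ v (g q) < v (g p) by lia.
  by exists (g p), (g q).
by exists (g q), (g p); rewrite reflC.
Qed.

Lemma reflectionJ t g : t \in T -> g \in <<S>> -> t ^ g \in T.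
Proof.
case/imset2P=> s h hs hh -> hg; apply/imset2P; exists s (h * g) => //.
  exact: groupM.
by rewrite conjgM.
Qed.

Lemma reflection_gen t : t \in T -> t \in <<S>>.
Proof. by case/imset2P=> s g hs hg ->; rewrite groupJ // mem_gen. Qed.

Lemma reflection_mulK t : t \in T -> t * t = 1.
Proof. by case/reflectionP=> p [q [_ ->]]; rewrite reflK. Qed.

Lemma simple_mulK s : simple s -> s * s = 1.
Proof. by case=> p [q [_ ->]]; rewrite reflK. Qed.

Lemma simpleK s : simple s -> involutive s.
Proof. by move=> hs x; rewrite -permM simple_mulK // perm1. Qed.

Lemma simpleV s : simple s -> s^-1 = s.
Proof. by move=> hs; apply/eqP; rewrite eq_invg_mul simple_mulK. Qed.

Lemma reflection_determined t x : t \in T -> t x != x -> t = refl x (t x).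
Proof. by case/reflectionP=> p [q [_ ->]]; apply: refl_moved. Qed.

Lemma reflection_up t : t \in T -> exists x, v x < v (t x).
Proof. by case/reflectionP=> p [q [h ->]]; exists p; rewrite reflL. Qed.

Lemma reflectionK t : t \in T -> involutive t.
Proof. by move=> ht x; rewrite -permM reflection_mulK // perm1. Qed.

(* Products act by [(u * w) x = w (u x)], so right multiplication permutes the
   values: [w * t] is compared with [w] through [w^-1]. *)
Definition inverts w t :=
  [exists x, (v x < v (t x)) && (v (w^-1 (t x)) < v (w^-1 x))].

(** The only other point raised by [t] is the opposite of [t x], and [w] commutes with opposites, so
    a single raised point decides. *)
Lemma invertsE w t x : w \in signed_perms n -> t \in T -> v x < v (t x) ->
  inverts w t = (v (w^-1 (t x)) < v (w^-1 x)).
Proof.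
move=> hw ht hx; have hV : w^-1 \in signed_group n by rewrite groupV.
apply/existsP/idP => [[y /andP[hy1 hy2]]|h]; last by exists x; rewrite hx.
have tE : t = refl x (t x).
  by apply: reflection_determined => //; rewrite pm_eq_v; lia.
have [e|e] : y = x \/ y = pm_opp (t x) by apply: refl_up => //; rewrite -tE.
  by rewrite -e.
move: hy2; rewrite e (signed_opp (gen_signed (reflection_gen ht))) reflectionK //.
by rewrite !(signed_opp hV) !pm_int_opp; lia.
Qed.

Lemma inverts1 t : inverts 1 t = false.
Proof. by apply/existsP=> -[x]; rewrite invg1 !perm1; lia. Qed.

Lemma inverts_mulr w t : w \in signed_perms n -> t \in T ->
  inverts (w * t) t = ~~ inverts w t.
Proof.
move=> hw ht; have [x hx] := reflection_up ht.
have hwt : w * t \in signed_group n by rewrite groupM // gen_signed ?reflection_gen.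
have tV : t^-1 = t by apply/eqP; rewrite eq_invg_mul reflection_mulK.
rewrite !(invertsE _ _ hx) // invMg tV !permM reflectionK //.
have ne : v (w^-1 x) != v (w^-1 (t x)).
  by rewrite (inj_eq (@pm_int_inj n)) (inj_eq perm_inj) pm_eq_v; lia.
by rewrite -leNgt lt_neqAle ne.
Qed.

(* A simple reflection only reverses the order of the two points it exchanges. *)
Lemma inverts_simple w s t : w \in signed_perms n -> simple s -> t \in T ->
  t != s -> inverts (w * s) t = inverts w (t ^ s).
Proof.
move=> hw hs ht nts; have [x hx] := reflection_up ht.
have hws : w * s \in signed_group n by rewrite groupM // simple_signed.
have hts : t ^ s \in T by rewrite reflectionJ ?simple_gen.
have e : (t ^ s) (s x) = s (t x) by rewrite conjgE simpleV // !permM simpleK.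
have hx' : v (s x) < v ((t ^ s) (s x)).
  rewrite e; apply: simple_mono => //; apply: contra nts => /eqP sx.
  have ne : t x != x by rewrite pm_eq_v; lia.
  rewrite (reflection_determined ht ne) -sx -reflection_determined ?simple_reflection //.
  by rewrite sx.
by rewrite (invertsE hws ht hx) (invertsE hw hts hx') e invMg (simpleV hs) !permM.
Qed.

Lemma expgs_gen k w : w \in S ^+ k -> w \in <<S>>.
Proof.
elim: k w => [|k IH] w; first by rewrite expg0 => /set1P ->.
by rewrite expgS => /mulsgP[s u hs hu ->]; rewrite groupM ?(mem_gen hs) ?(IH _ hu).
Qed.

(** The strong exchange condition, by induction on the last letter: if it is [t], it cancels;
    otherwise [t], moved past it, becomes a conjugate that the prefix inverts. *)
Lemma expgs_deletion k w t : w \in S ^+ k.+1 -> t \in T -> inverts w t ->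
  w * t \in S ^+ k.
Proof.
elim: k w t => [|k IH] w t; rewrite expgSr => /mulsgP[w' s hw' hs ->] ht.
  move: hw'; rewrite expg0 => /set1P ->; rewrite mul1g.
  case: (eqVneq t s) => [-> _|nts]; first by rewrite simple_mulK ?set11 //; apply/simpleP.
  by rewrite -[s]mul1g inverts_simple ?(group1 (signed_group n)) ?inverts1 //; apply/simpleP.
move/simpleP: hs => hs; have hw1 := gen_signed (expgs_gen hw').
case: (eqVneq t s) => [-> _|nts].
  by rewrite -mulgA simple_mulK // mulg1.
rewrite inverts_simple // => /(IH _ _ hw').
rewrite reflectionJ ?simple_gen // => /(_ isT) h.
have -> : w' * s * t = w' * t ^ s * s.
  by rewrite conjgE simpleV // !mulgA -!mulgA simple_mulK // mulg1.
by rewrite expgSr mem_mulg //; apply/simpleP.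
Qed.

End BruhatB.

(** * Length as the least power of the generating set *)

Section CoxeterLength.
Import GroupScope.
Local Open Scope group_scope.
Variables (gT : finGroupType) (S : {set gT}).

Lemma cox_length_le w k : w \in S ^+ k -> cox_length S w <= k.
Proof.
move=> hw; rewrite leqNgt; apply/negP => lt.
(* [find] returns at most the size of the searched list, so [k] lies in the range searched. *)
have lk : k < #|gT|.
  by apply: leq_trans lt _; rewrite /cox_length -[X in _ <= X](size_iota 0) find_size.
by have := before_find 0 lt; rewrite nth_iota // add0n hw.
Qed.

Lemma gen_expgs_mem w : w \in <<S>> -> exists k, w \in S ^+ k.
Proof.
have [m ->] := gen_expgs S; elim: m w => [|m IH] w.
  by rewrite expg0 => hw; exists 0; rewrite expg0.
rewrite expgS => /mulsgP[x y /setU1P[->|hx] /IH[k hk] ->]; first by exists k; rewrite mul1g.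
by exists k.+1; rewrite expgS mem_mulg.
Qed.

(* The prefixes of a shortest word have pairwise distinct lengths, so a
   shortest word has fewer than [#|gT|] letters. *)
Lemma mem_expgs_cox_length w : w \in <<S>> -> w \in S ^+ cox_length S w.
Proof.
move/gen_expgs_mem => ex; have [k hk kmin] := ex_minnP ex.
have [x hx] : exists x : 'I_k.+1 -> gT, forall j : 'I_k.+1,
    x j \in S ^+ j /\ forall i, i < j -> x j \notin S ^+ i.
  apply: (@fin_all_exists 'I_k.+1 (fun=> gT)
    (fun j u => u \in S ^+ j /\ forall i, i < j -> u \notin S ^+ i)) => j.
  have jk : j <= k by rewrite -ltnS.
  have : w \in S ^+ (j + (k - j)) by rewrite subnKC.
  rewrite expgnDr => /mulsgP[u u' hu hu' wE].
  exists u; split=> // i ij; apply/negP=> ui.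
  have : w \in S ^+ (i + (k - j)) by rewrite wE expgnDr mem_mulg.
  by move/kmin; lia.
have lk : k < #|gT|.
  rewrite -[k.+1]card_ord; apply: (@leq_card _ _ x) => i j e; apply: val_inj.
  have [hi1 hi2] := hx i; have [hj1 hj2] := hx j.
  case: (ltngtP i j) => // lt; first by have := hj2 _ lt; rewrite -e hi1.
  by have := hi2 _ lt; rewrite e hj1.
have hh : has (fun k => w \in S ^+ k) (iota 0 #|gT|).
  by apply/hasP; exists k => //; rewrite mem_iota.
have := nth_find 0 hh; rewrite -/(cox_length S w) nth_iota //.
by rewrite has_find size_iota in hh.
Qed.

End CoxeterLength.

(** * Bruhat order through inversions, and the lifting property *)

Section BruhatMonotone.
Import Order.TTheory GRing.Theory Num.Theory GroupScope.
Local Open Scope ring_scope.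
Local Open Scope group_scope.
Local Notation v := (@pm_int _).
Variable n : nat.
Implicit Types (x y z p q a b : pm n) (u w s t r : {perm pm n}).
Local Notation S := (gensB n).
Local Notation T := (reflections S).
Local Notation len := (cox_length S).

(** Deletion shows that an inverted reflection shortens [w]; if [t] is not inverted by [w], it is
    inverted by [w * t], and deletion applies there. *)
Lemma cox_length_inverts w t : w \in <<S>> -> t \in T ->
  (len (w * t) < len w)%N = inverts w t.
Proof.
have lower u : u \in <<S>> -> t \in T -> inverts u t -> (len (u * t) < len u)%N.
  move=> hu ht it; have := mem_expgs_cox_length hu.
  case: (len u) => [|k].
    by rewrite expg0 => /set1P u1; rewrite u1 inverts1 in it.
  by move=> hk; rewrite ltnS; apply/cox_length_le/expgs_deletion.
move=> hw ht; apply/idP/idP; last exact: lower.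
apply: contraTT => ni; rewrite -leqNgt ltnW //.
rewrite -{1}[w]mulg1 -(reflection_mulK ht) mulgA; apply: lower => //.
  by rewrite groupM // reflection_gen.
by rewrite inverts_mulr // gen_signed.
Qed.

Lemma bruhat_stepP u w : u \in <<S>> ->
  reflect (exists2 t, t \in T & ~~ inverts u t /\ w = u * t) (bruhat_step S u w).
Proof.
move=> hu.
have cmp t : t \in T -> (len u < len (u * t))%N = ~~ inverts u t.
  move=> ht; rewrite -inverts_mulr ?gen_signed // -cox_length_inverts //.
    by rewrite -mulgA reflection_mulK // mulg1.
  by rewrite groupM // reflection_gen.
apply: (iffP andP) => [[lt /existsP[t /andP[ht /eqP e]]]|[t ht [ni ->]]].
  by exists t => //; rewrite -cmp // -e.
by rewrite cmp //; split=> //; apply/existsP; exists t; rewrite ht eqxx.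
Qed.

Lemma bruhat_step_gen u w : bruhat_step S u w -> (u \in <<S>>) = (w \in <<S>>).
Proof.
by case/andP=> _ /existsP[t /andP[ht /eqP ->]]; rewrite (groupMr _ (reflection_gen ht)).
Qed.

(** The order relates arbitrary permutations of [±n]; steps multiply by reflections, so membership
    in the Coxeter group is constant along a chain. *)
Lemma leB_gen u w : leB u w -> (u \in <<S>>) = (w \in <<S>>).
Proof.
case/connectP=> c + ->; elim: c u => [|a c IH] u //= /andP[h1 h2].
by rewrite (bruhat_step_gen h1) IH.
Qed.

Lemma leB_refl u : leB u u.
Proof. exact: connect0. Qed.

Lemma leB_trans u w r : leB u w -> leB w r -> leB u r.
Proof. exact: connect_trans. Qed.

Lemma leB_step u w : bruhat_step S u w -> leB u w.
Proof. exact: connect1. Qed.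

Lemma leB_ind (R : {perm pm n} -> {perm pm n} -> Prop) :
  (forall u, R u u) -> (forall u w r, R u w -> R w r -> R u r) ->
  (forall u w, u \in <<S>> -> bruhat_step S u w -> R u w) ->
  forall u w, u \in <<S>> -> leB u w -> R u w.
Proof.
move=> R0 Rt R1 u w hu /connectP[c + ->].
elim: c u hu => [|a c IH] u hu //= /andP[h1 h2].
apply: Rt (R1 _ _ hu h1) (IH _ _ h2).
by rewrite -(bruhat_step_gen h1).
Qed.

Lemma leB_cox_length u w : leB u w -> (len u <= len w)%N.
Proof.
case/connectP=> c + ->; elim: c u => [|a c IH] u //= /andP[/andP[h1 _] /IH].
exact/leq_trans/ltnW.
Qed.

Definition desc s w := inverts w s.

Lemma desc_mulr s w : w \in <<S>> -> simple s -> desc s (w * s) = ~~ desc s w.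
Proof. by move=> hw hs; rewrite /desc inverts_mulr ?gen_signed ?simple_reflection. Qed.

Lemma desc_step s w : w \in <<S>> -> simple s -> desc s w -> bruhat_step S (w * s) w.
Proof.
move=> hw hs ds; have hws : w * s \in <<S>> by rewrite groupM // simple_gen.
apply/bruhat_stepP => //; exists s; first exact: simple_reflection.
by rewrite -/(desc _ _) desc_mulr // negbK ds -mulgA simple_mulK // mulg1.
Qed.

Lemma asc_step s w : w \in <<S>> -> simple s -> ~~ desc s w -> bruhat_step S w (w * s).
Proof. by move=> hw hs ds; apply/bruhat_stepP => //; exists s; [apply: simple_reflection | split]. Qed.

(** The larger and the smaller of [w] and [w * s]; the lifting property is used in the form that
    both maps are monotone. *)
Definition rmax s w := if desc s w then w else w * s.
Definition rmin s w := if desc s w then w * s else w.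

Lemma rmax_gen s w : simple s -> (rmax s w \in <<S>>) = (w \in <<S>>).
Proof. by move=> hs; rewrite /rmax; case: ifP; rewrite // (groupMr _ (simple_gen hs)). Qed.

Lemma rmin_gen s w : simple s -> (rmin s w \in <<S>>) = (w \in <<S>>).
Proof. by move=> hs; rewrite /rmin; case: ifP; rewrite // (groupMr _ (simple_gen hs)). Qed.

(** Right multiplication by [s] turns a step by [t] into one by [t ^ s], with the same inversion
    status unless [t] is [s]. *)
Lemma bruhat_step_mulr s u w : simple s -> u \in <<S>> -> bruhat_step S u w ->
  w = u * s \/ bruhat_step S (u * s) (w * s).
Proof.
move=> hs hu /(bruhat_stepP _ hu)[t ht [ni ->]].
case: (eqVneq t s) => [->|nts]; [by left | right].
apply/bruhat_stepP; first by rewrite groupM // simple_gen.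
exists (t ^ s); first by rewrite reflectionJ ?simple_gen.
split; last by rewrite conjgE simpleV // !mulgA -!mulgA (mulgA s s) simple_mulK // mul1g.
have hts : t ^ s != s.
  apply: contra nts => /eqP/(canRL (conjgK _)); rewrite simpleV // => ->.
  by rewrite conjgE simpleV // simple_mulK // mulg1.
rewrite inverts_simple ?gen_signed //; last by rewrite reflectionJ ?simple_gen.
by rewrite -conjgM simple_mulK // conjg1.
Qed.

Lemma rmax_rmin_step s u w : simple s -> u \in <<S>> -> bruhat_step S u w ->
  leB (rmax s u) (rmax s w) /\ leB (rmin s u) (rmin s w).
Proof.
move=> hs hu h; have hw : w \in <<S>> by rewrite -(bruhat_step_gen h).
have uw := leB_step h.
have us := asc_step hu hs; have ws := asc_step hw hs.
have us' := desc_step hu hs; have ws' := desc_step hw hs.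
case: (bruhat_step_mulr hs hu h) => [e|/leB_step h'].
  have e' : desc s w = ~~ desc s u by rewrite e desc_mulr.
  rewrite /rmax /rmin e'; case: (boolP (desc s u)) => /= d.
    by rewrite e -mulgA simple_mulK // mulg1 !leB_refl.
  by rewrite e -mulgA simple_mulK // mulg1 !leB_refl.
rewrite /rmax /rmin.
case: (boolP (desc s u)) us us' => [du _ /(_ isT)/leB_step us|du /(_ isT)/leB_step us _];
case: (boolP (desc s w)) ws ws' => [dw _ /(_ isT)/leB_step ws|dw /(_ isT)/leB_step ws _];
split=> //.
- exact: leB_trans uw ws.
- exact: leB_trans us uw.
- exact: leB_trans h' ws.
- exact: leB_trans us h'.
Qed.

Lemma leB_rmax s u w : simple s -> u \in <<S>> -> leB u w -> leB (rmax s u) (rmax s w).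
Proof.
move=> hs; apply: (@leB_ind (fun u w => leB (rmax s u) (rmax s w))) => [w0|u0 w0 r|u0 w0 h0 h].
- exact: leB_refl.
- exact: leB_trans.
- by have [] := rmax_rmin_step hs h0 h.
Qed.

Lemma leB_rmin s u w : simple s -> u \in <<S>> -> leB u w -> leB (rmin s u) (rmin s w).
Proof.
move=> hs; apply: (@leB_ind (fun u w => leB (rmin s u) (rmin s w))) => [w0|u0 w0 r|u0 w0 h0 h].
- exact: leB_refl.
- exact: leB_trans.
- by have [] := rmax_rmin_step hs h0 h.
Qed.

Lemma le_rmax s w : simple s -> w \in <<S>> -> leB w (rmax s w).
Proof.
move=> hs hw; rewrite /rmax; case: ifPn => [_|d]; first exact: leB_refl.
exact/leB_step/asc_step.
Qed.

Lemma le_rmin s w : simple s -> w \in <<S>> -> leB (rmin s w) w.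
Proof.
move=> hs hw; rewrite /rmin; case: ifPn => [d|_]; last exact: leB_refl.
exact/leB_step/desc_step.
Qed.

(* [u * t = (t ^ u^-1) * u], and [t] is inverted by [u] iff [t ^ u^-1] is
   inverted by [u^-1]. *)
Lemma leB_inv u w : u \in <<S>> -> leB u w -> leB u^-1 w^-1.
Proof.
apply: (@leB_ind (fun u w => leB u^-1 w^-1)) => [w0|u0 w0 r|u' w0 hu' /(bruhat_stepP _ hu')[t ht [ni ->]]].
- exact: leB_refl.
- exact: leB_trans.
have huV : u'^-1 \in <<S>> by rewrite groupV.
apply/leB_step/bruhat_stepP => //; exists (t ^ u'^-1); first exact: reflectionJ.
have tV : t^-1 = t by apply/eqP; rewrite eq_invg_mul reflection_mulK.
split; last by rewrite invMg tV conjgE invgK !mulgA mulVg mul1g.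
have hJ := reflectionJ ht huV.
apply: contra ni => /existsP[x /andP[]].
rewrite conjgE invgK !permM permKV => h1 h2.
apply/existsP; exists (t (u' x)).
by rewrite (reflectionK ht) h2 permK h1.
Qed.

End BruhatMonotone.

(** * Involutions and supports *)

Section Involutions.
Import Order.TTheory GRing.Theory Num.Theory GroupScope.
Local Open Scope ring_scope.
Local Open Scope group_scope.
Local Notation v := (@pm_int _).
Variable n : nat.
Implicit Types (x y z p q a b : pm n) (u w s t r : {perm pm n}).
Local Notation S := (gensB n).
Local Notation len := (cox_length S).

Lemma exists_desc w : w \in <<S>> -> w != 1 -> exists s, simple s /\ desc s w.
Proof.
move=> hw w1; have := mem_expgs_cox_length hw.
case E: (len w) => [|k]; first by rewrite expg0 => /set1P e; rewrite e eqxx in w1.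
rewrite expgSr => /mulsgP[u s hu hs e]; exists s; have hs' : simple s by apply/simpleP.
split=> //; rewrite /desc -cox_length_inverts ?simple_reflection //.
rewrite e -mulgA simple_mulK // mulg1 -e E ltnS.
exact: cox_length_le.
Qed.

Lemma leB1 w : w \in <<S>> -> leB 1 w.
Proof.
have [k] := ubnP (len w); elim: k w => // k IH w lt hw.
case: (eqVneq w 1) => [->|w1]; first exact: leB_refl.
have [s [hs ds]] := exists_desc hw w1; have st := desc_step hw hs ds.
apply: leB_trans (leB_step st); apply: IH; last by rewrite (bruhat_step_gen st).
by case/andP: st => + _; lia.
Qed.

Lemma desc1 s : desc s 1 = false.
Proof. exact: inverts1. Qed.

Lemma desc_le s w : simple s -> w \in <<S>> -> desc s w -> leB s w.
Proof.
move=> hs hw ds; have := leB_rmax hs (group1 _) (leB1 hw).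
by rewrite /rmax desc1 ds mul1g.
Qed.

Lemma leB_1 w : leB w 1 -> w = 1.
Proof.
move=> h; have hw : w \in <<S>> by rewrite (leB_gen h) group1.
have := mem_expgs_cox_length hw; have := leB_cox_length h.
have /cox_length_le : (1 : {perm pm n}) \in S ^+ 0 by rewrite expg0 set11.
by rewrite leqn0 => /eqP ->; rewrite leqn0 => /eqP ->; rewrite expg0 => /set1P.
Qed.

(** A descent [s] of the single letter [r] would leave a word of length 0, making [r * s]
    trivial. *)
Lemma desc_simple r s : simple r -> simple s -> r != s -> desc s r = false.
Proof.
move=> hr hs; apply: contraNF => ds; apply/eqP.
have /bruhat_stepP[|t ht [_ e]] := desc_step (simple_gen hr) hs ds.
  by rewrite groupM // simple_gen.
have : r * s = 1.
  have lr : (len r <= 1)%N by apply: cox_length_le; rewrite expg1; apply/simpleP.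
  have := desc_step (simple_gen hr) hs ds; case/andP=> lt _.
  have hrs : r * s \in <<S>> by rewrite groupM // simple_gen.
  have := mem_expgs_cox_length hrs.
  have -> : len (r * s) = 0 by lia.
  by rewrite expg0 => /set1P.
by move/(canRL (mulgK _)); rewrite mul1g simpleV.
Qed.

Definition invol w := w \in <<S>> /\ w^-1 = w.

Lemma invol1 : invol 1.
Proof. by split; rewrite ?group1 ?invg1. Qed.

Lemma invol_simple s : simple s -> invol s.
Proof. by move=> hs; split; [apply: simple_gen | apply: simpleV]. Qed.

Lemma involK w : invol w -> involutive w.
Proof. by case=> _ e x; rewrite -{1}e permK. Qed.

(* The action of [s] on involutions written [w * s] with an underlined star in
   the literature. *)
Definition twist s w := if s * w * s == w then w * s else s * w * s.

Lemma twist_comm s w : simple s -> s * w * s = w -> s * w = w * s.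
Proof. by move=> hs e; rewrite -{2}e -mulgA simple_mulK // mulg1. Qed.

Lemma invol_twist s w : simple s -> invol w -> invol (twist s w).
Proof.
move=> hs [hw wV]; rewrite /twist; case: eqP => [e|_]; split.
- by rewrite groupM // simple_gen.
- by rewrite invMg wV (simpleV hs) (twist_comm hs e).
- by rewrite !groupM // simple_gen.
- by rewrite !invMg wV (simpleV hs) mulgA.
Qed.

Lemma twistK s w : simple s -> twist s (twist s w) = w.
Proof.
move=> hs; have ss := simple_mulK hs.
have sKr u : u * s * s = u by rewrite -mulgA ss mulg1.
have sKl u : s * (s * u) = u by rewrite mulgA ss mul1g.
rewrite {2}/twist; case: eqP => [e|ne]; rewrite /twist.
  by rewrite !mulgA e eqxx sKr.
by rewrite -!mulgA sKl ss mulg1 eq_sym; case: eqP => // h; case: ne; rewrite -mulgA.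
Qed.

(** [s ^ w] is a reflection sending [w x] to [w (s x)]; as [s] does the same and one moved point
    determines a reflection, the two are equal. *)
Lemma twist_comm_at s w x : simple s -> invol w -> s x != x -> s (w x) = w (s x) ->
  s * w * s = w.
Proof.
move=> hs [hw wV] sx e.
have sw : w * w = 1 by rewrite -{1}wV mulVg.
have : s ^ w = s.
  rewrite {1}(reflection_determined (simple_reflection hs) sx) reflJ ?gen_signed // -e.
  by rewrite -reflection_determined ?simple_reflection // e (inj_eq perm_inj).
rewrite conjgE wV => e2.
have -> : s * w = w * s by rewrite -{2}e2 !mulgA sw mul1g.
by rewrite -mulgA simple_mulK // mulg1.
Qed.

Lemma desc_twist_aux s w : simple s -> invol w -> s * w * s != w ->
  desc s (s * w) = desc s w.
Proof.
move=> hs [hw wV] nc.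
have [x hx] := reflection_up (simple_reflection hs).
have hsw : s * w \in <<S>> by rewrite groupM // simple_gen.
have sw : w * w = 1 by rewrite -{1}wV mulVg.
have wK y : w (w y) = y by rewrite -permM sw perm1.
have ne : s (w x) != w (s x).
  apply: contra nc => /eqP e; apply/eqP/(twist_comm_at hs (conj hw wV) _ e).
  by rewrite pm_eq_v; lia.
rewrite /desc !(invertsE _ _ hx) ?gen_signed ?simple_reflection // invMg wV (simpleV hs) !permM.
case: (ltrP (v (w (s x))) (v (w x))) => h.
  apply: simple_mono => //; apply: contra ne => /eqP <-.
  by rewrite simpleK.
have : v (s (w x)) < v (s (w (s x))).
  apply: simple_mono => //; rewrite lt_neqAle h andbT -pm_eq_v (inj_eq perm_inj) pm_eq_v; lia.
lia.
Qed.

Lemma desc_twist s w : simple s -> invol w -> desc s (twist s w) = ~~ desc s w.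
Proof.
move=> hs iw; have [hw wV] := iw; rewrite /twist; case: ifPn => [_|nc].
  exact: desc_mulr.
by rewrite desc_mulr ?desc_twist_aux // groupM // simple_gen.
Qed.

(** Two-sided versions of [rmax] and [rmin], applied on the right and then on the left through
    inverses. On an involution each is the identity or [twist s], which gives the monotonicity
    needed for [twist]. *)
Definition up s w := (rmax s (rmax s w)^-1)^-1.
Definition dn s w := (rmin s (rmin s w)^-1)^-1.

Lemma leB_up s u w : simple s -> u \in <<S>> -> leB u w -> leB (up s u) (up s w).
Proof.
move=> hs hu h; apply: leB_inv; first by rewrite rmax_gen // groupV rmax_gen.
apply: leB_rmax => //; first by rewrite groupV rmax_gen.
by apply: leB_inv; rewrite ?rmax_gen //; apply: leB_rmax.
Qed.

Lemma leB_dn s u w : simple s -> u \in <<S>> -> leB u w -> leB (dn s u) (dn s w).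
Proof.
move=> hs hu h; apply: leB_inv; first by rewrite rmin_gen // groupV rmin_gen.
apply: leB_rmin => //; first by rewrite groupV rmin_gen.
by apply: leB_inv; rewrite ?rmin_gen //; apply: leB_rmin.
Qed.

Lemma le_up s w : simple s -> w \in <<S>> -> leB w (up s w).
Proof.
move=> hs hw; apply: leB_trans (le_rmax hs hw) _.
rewrite /up -{1}[rmax s w]invgK; apply: leB_inv; rewrite ?groupV ?rmax_gen //.
by apply: le_rmax; rewrite ?groupV ?rmax_gen.
Qed.

Lemma upE s w : simple s -> invol w -> up s w = if desc s w then w else twist s w.
Proof.
move=> hs iw; have [hw wV] := iw; rewrite /up /rmax.
case: (boolP (desc s w)) => d; first by rewrite wV d wV.
rewrite invMg wV (simpleV hs); rewrite /twist.
case: (s * w * s =P w) => [/(twist_comm hs) e|/eqP nc].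
  by rewrite e desc_mulr // d /= invMg wV simpleV.
by rewrite desc_twist_aux // (negbTE d) !invMg wV (simpleV hs) mulgA.
Qed.

Lemma dnE s w : simple s -> invol w -> dn s w = if desc s w then twist s w else w.
Proof.
move=> hs iw; have [hw wV] := iw; rewrite /dn /rmin.
case: (boolP (desc s w)) => d; last by rewrite wV (negbTE d) wV.
rewrite invMg wV (simpleV hs); rewrite /twist.
case: (s * w * s =P w) => [/(twist_comm hs) e|/eqP nc].
  by rewrite e desc_mulr // d /= invMg wV simpleV.
by rewrite desc_twist_aux // d !invMg wV (simpleV hs) mulgA.
Qed.

Lemma le_twist s w : simple s -> invol w -> ~~ desc s w -> leB w (twist s w).
Proof. by move=> hs iw d; have := le_up hs iw.1; rewrite upE // (negbTE d). Qed.

Lemma twist_le s w : simple s -> invol w -> desc s w -> leB (twist s w) w.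
Proof.
move=> hs iw d; rewrite -{2}(twistK w hs); apply: le_twist => //; first exact: invol_twist.
by rewrite desc_twist // d.
Qed.

Lemma twist_neq s w : simple s -> invol w -> twist s w != w.
Proof.
by move=> hs iw; apply/eqP=> e; have := desc_twist hs iw; rewrite e; case: desc.
Qed.

Lemma cox_length_twist s w : simple s -> invol w -> desc s w ->
  (len (twist s w) < len w)%N.
Proof.
move=> hs iw d; have [hw _] := iw; rewrite /twist; case: ifPn => [_|nc].
  by rewrite cox_length_inverts // simple_reflection.
have hsw : s * w \in <<S>> by rewrite groupM // simple_gen.
have : (len (s * w * s) < len (s * w))%N.
  by rewrite cox_length_inverts ?simple_reflection // -/(desc _ _) desc_twist_aux.
move/leq_trans; apply; have := leB_cox_length (le_rmin hs hw).
rewrite /rmin d => h; have := leB_inv (groupM hw (simple_gen hs)) (leB_step (desc_step hw hs d)).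
by rewrite invMg iw.2 (simpleV hs) => /leB_cox_length.
Qed.

(** The monotone map [dn s] fixes [r] and undoes the twist, so twisting upwards adds no generator
    other than [s]. *)
Lemma supp_twist r s w : simple r -> simple s -> r != s -> invol w -> ~~ desc s w ->
  leB r (twist s w) -> leB r w.
Proof.
move=> hr hs nrs iw d h; have ir := invol_simple hr.
have := leB_dn hs ir.1 h; rewrite (dnE hs ir) (dnE hs (invol_twist hs iw)).
by rewrite (desc_simple hr hs nrs) desc_twist // d twistK.
Qed.

Definition crosses w p q := exists x, v x <= v p /\ v q <= v (w x).

(** A crossing persists upwards in Bruhat order, which gives one direction. Conversely, stripping a
    descent either keeps the given crossing or destroys it, and in the latter case the descent is
    the generator of that gap. *)
Lemma leB_crosses p q w : adjacent p q -> w \in <<S>> ->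
  leB (refl p q) w <-> crosses w p q.
Proof.
move=> h; have hs : simple (refl p q) by exists p, q.
move=> hw; split=> [le|]; last first.
  have [k] := ubnP (len w); elim: k w hw => // k IH w hw lt [x [h1 h2]].
  case: (eqVneq w 1) => [e|w1]; first by move: h2; rewrite e perm1; have [] := h; lia.
  have [s [hs' ds]] := exists_desc hw w1; have st := desc_step hw hs' ds.
  case: (lerP (v q) (v (s (w x)))) => h3.
    apply: leB_trans (leB_step st); apply: IH; first by rewrite (bruhat_step_gen st).
      by case/andP: st => + _; lia.
    by exists x; rewrite permM.
  suff -> : refl p q = s by apply: desc_le.
  case: hs' => a [b [hab sE]]; have [hab1 hab2] := hab; have [hpq1 hpq2] := h.
  have [e|e] : s (w x) = a \/ s (w x) = pm_opp b.
  - apply: refl_up hab1 _; rewrite -sE simpleK //; last by exists a, b.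
    by have := hpq2 (s (w x)); lia.
  - have wb : w x = b by rewrite -[w x](@simpleK _ s) ?e; [rewrite sE reflL | exists a, b].
    rewrite e in h3; rewrite wb in h2; rewrite sE; congr refl; apply: pm_int_inj.
      by have := hpq2 a; have := hab2 p; lia.
    by have := hpq2 a; have := hab2 q; lia.
  - have wb : w x = pm_opp a.
      by rewrite -[w x](@simpleK _ s) ?e; [rewrite sE -refl_opp reflR | exists a, b].
    rewrite e pm_int_opp in h3; rewrite wb pm_int_opp in h2.
    have -> : s = refl (pm_opp b) (pm_opp a) by rewrite sE refl_opp reflC.
    congr refl; apply: pm_int_inj.
      by have := hpq2 (pm_opp b); have := hab2 (pm_opp p); rewrite !pm_int_opp; lia.
    by have := hpq2 (pm_opp b); have := hab2 (pm_opp q); rewrite !pm_int_opp; lia.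
suff H : forall u r, u \in <<S>> -> leB u r -> crosses u p q -> crosses r p q.
  by apply: (H _ _ (simple_gen hs) le); exists p; rewrite reflL; split.
apply: (@leB_ind _ (fun u r => crosses u p q -> crosses r p q)) => [//|u w0 r h1 h2 /h1 //|].
move=> u r hu /(bruhat_stepP _ hu)[t ht [ni ->]] [x [h1 h2]].
case: (lerP (v q) (v (t (u x)))) => h3; first by exists x; rewrite permM.
(* The point that [u * t] sends to [u x]; it lies at or below [x] because [u] does not invert
   [t]. *)
exists (u^-1 (t (u x))); rewrite permM permKV reflectionK //; split=> //.
move: ni; rewrite (@invertsE _ _ _ (t (u x))) ?gen_signed ?reflectionK //; last lia.
by rewrite permK; lia.
Qed.

End Involutions.

(** * Arcs of an involution *)

Section Arcs.
Import Order.TTheory GRing.Theory Num.Theory GroupScope.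
Local Open Scope ring_scope.
Local Open Scope group_scope.
Local Notation v := (@pm_int _).
Variable n : nat.
Implicit Types (x y z p q a b : pm n) (u w s t r : {perm pm n}).
Local Notation S := (gensB n).

Definition nested w := exists x y, [/\ v x < v y, v y < v (w y) & v (w y) < v (w x)].

Definition loose w := exists x y z,
  [/\ v x < v y, v y < v z, v z < v (w x) & v (w x) < v (w y)].

Definition tight w := ~ nested w /\ ~ loose w.

Lemma simple_gap s b z : simple s -> v b < v (s b) -> v z <= v b \/ v (s b) <= v z.
Proof.
case=> p [q [h ->]] hb; have [h1 h2] := h.
have [e|e] := refl_up h1 hb; first by rewrite e reflL.
rewrite e -refl_opp reflR; exact: (adjacent_opp h).2.
Qed.

(** Quantifying over the lower points [b] of exchanged pairs covers the gap of the generator and its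
    mirror image at once. *)
Definition noncrossing w s := forall a b, v b < v (s b) -> v a <= v b -> v (w a) <= v b.

(** A crossing of the mirror gap becomes, after negating the arc and exchanging its ends, a crossing
    of the given gap. *)
Lemma crosses_noncrossing p q w : adjacent p q -> invol w -> ~ crosses w p q ->
  noncrossing w (refl p q).
Proof.
move=> h iw nc a b hb hab; have [h1 h2] := h.
have hw := signed_opp (gen_signed iw.1).
have nc' x : v x <= v p -> v (w x) <= v p.
  by move=> hx; case: (h2 (w x)) => // hx'; case: nc; exists x.
have [e|e] := refl_up h1 hb; rewrite e in hab *; first exact: nc'.
rewrite pm_int_opp in hab *; rewrite lerNr leNgt; apply/negP => lt.
have := nc' (pm_opp (w a)); rewrite hw involK // !pm_int_opp.
by have := h2 (pm_opp (w a)); rewrite !pm_int_opp; lia.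
Qed.

Lemma noncrossing_crosses p q w : adjacent p q -> noncrossing w (refl p q) ->
  ~ crosses w p q.
Proof.
move=> [h1 _] nc [x [hx1 hx2]].
by have := nc x p; rewrite reflL => /(_ h1 hx1); lia.
Qed.

Lemma pm_neqE x y : v x <> v y -> x != y.
Proof. by move=> h; apply/eqP => e; apply: h; rewrite e. Qed.

Lemma noncrossing_fixed w s b : simple s -> invol w -> noncrossing w s ->
  s * w = w * s -> s b != b -> w b = b.
Proof.
move=> hs iw nc cm.
have cmE x : w (s x) = s (w x) by rewrite -!permM cm.
have fix_low b' : v b' < v (s b') -> w b' = b'.
  move=> hb; apply: pm_int_inj.
  have h1 := nc b' b' hb (lexx _).
  have h2 : v (s b') <= v (s (w b')).
    case: (simple_gap (w (s b')) hs hb); rewrite cmE // -cmE => h.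
    by have := nc _ _ hb h; rewrite involK //; lia.
  have hc : v (w b') < v (s (w b')) by lia.
  by case: (simple_gap b' hs hc); lia.
rewrite pm_eq_v => hb; have [lt|lt] : v b < v (s b) \/ v (s b) < v b by lia.
  exact: fix_low.
apply: (@perm_inj _ s); rewrite -cmE fix_low // simpleK //.
Qed.

Lemma twistE s w x : simple s -> twist s w x =
  if s * w * s == w then s (w x) else s (w (s x)).
Proof. by move=> hs; rewrite /twist; case: ifP; rewrite !permM. Qed.

(** Twisting either adds the arcs of [s], each spanning a single uncrossed gap, or conjugates by
    [s]. A nesting or loose crossing created by conjugation would require an exchanged pair in the
    configuration, and then an arc of [w] across the gap. *)
Lemma tight_twist_up s w : simple s -> invol w -> noncrossing w s -> tight w ->
  tight (twist s w).
Proof.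
move=> hs iw nc [nn nl].
have sK := simpleK hs; have wK := involK iw.
have mono x y := @simple_mono _ s x y hs.
have gap b z := @simple_gap s b z hs.
have nstart x : v x < v (s x) -> v x < v (w x) -> False.
  by move=> h1 h2; have := nc x x h1; lia.
have nend x b : v b < v (s b) -> v x < v (s b) -> w x = s b -> False.
  move=> h1 h2 h3; case: (gap b x h1) => h4; last lia.
  by have := nc _ _ h1 h4; rewrite h3; lia.
case: (s * w * s =P w) => [e|ne].
  have cm := twist_comm hs e.
  have moved x : s x != x -> w x = x by apply: noncrossing_fixed.
  have twE x : twist s w x = if s x == x then w x else s x.
    rewrite twistE // e eqxx; case: (eqVneq (s x) x) => [ex|nx]; last by rewrite moved.
    by rewrite -permM -cm permM ex.
  split=> [[x [y]]|[x [y [z]]]]; rewrite !twE.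
    case: eqVneq => [_|nx]; case: eqVneq => [_|ny] [h1 h2 h3].
    + by apply: nn; exists x, y.
    + by case: (gap x y); lia.
    + by have := nc x y h2; lia.
    + by case: (gap x y); lia.
  case: eqVneq => [_|nx]; case: eqVneq => [_|ny] [h1 h2 h3 h4].
  + by apply: nl; exists x, y, z.
  + by case: (gap y z); lia.
  + by case: (gap x y); lia.
  + by case: (gap x y); lia.
have twE x : twist s w x = s (w (s x)) by rewrite twistE // (introF eqP ne).
(* An arc going up comes from an arc of [w] going up: otherwise [s] would exchange its ends and so
   commute with [w]. *)
have arc x : v x < v (twist s w x) -> v (s x) < v (w (s x)).
  move=> hx; rewrite -[w _]sK -twE; apply: mono => //; apply/eqP => e.
  apply: ne; apply: (twist_comm_at hs iw (x := x)); first by rewrite pm_eq_v e; lia.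
  have : w (s x) = x by rewrite -[w _]sK -twE -e sK.
  by move=> e2; rewrite e2 -{1}e2 wK sK.
have split_pair x y : v x < v y -> v (s x) < v (s y) \/ s x = y.
  by move=> h; case: (eqVneq (s x) y) => [|h']; [right | left; apply: mono].
have sT x : s (twist s w x) = w (s x) by rewrite twE sK.
split=> [[x [y [h1 h2 h3]]]|[x [y [z [h1 h2 h3 h4]]]]].
  have ax := arc x; have ay := arc y.
  case: (split_pair _ _ h1) => [h1'|e].
    case: (split_pair _ _ h3) => [h3'|e'].
      by apply: nn; exists (s x), (s y); rewrite -!sT; split=> //; rewrite sT; lia.
    by apply: (@nend (s y) (twist s w y)); rewrite -?sT ?e' //; rewrite -e' sT; lia.
  by move: (ay h2); rewrite -e sK; apply: nstart; rewrite e.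
have ax := arc x; have ay := arc y.
case: (split_pair _ _ h1) => [h1'|e]; last first.
  have ey : s y = x by rewrite -e sK.
  by rewrite ey in ay; apply: (@nstart x); rewrite ?e //; apply: ay; lia.
case: (split_pair _ _ h4) => [h4'|e]; last first.
  by apply: (@nend (s x) (twist s w x)); rewrite -?sT ?e //; rewrite -e sT; lia.
case: (split_pair _ _ h2) => [h2'|e]; last first.
  have h5 : v (s z) < v (s (twist s w x)).
    by apply: mono => //; rewrite -e sK; apply: pm_neqE; lia.
  have hb : v y < v (s y) by rewrite e.
  rewrite -e sK sT in h5; rewrite e in h1'.
  by have := nc (s x) y hb; case: (gap y (s x) hb); rewrite ?e; lia.
case: (split_pair _ _ h3) => [h3'|e]; last first.
  have hb : v z < v (s z) by rewrite e.
  have h5 : v (s (twist s w x)) < v (s (twist s w y)).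
    by apply: mono => //; rewrite -e sK; apply: pm_neqE; lia.
  rewrite -e sK sT in h5.
  by have := nc (s y) z hb; case: (gap z (s y) hb); lia.
by apply: nl; exists (s x), (s y), (s z); rewrite -!sT.
Qed.

(** At a descent, tightness leaves no arc over the exchanged pair except those ending in it, and
    twisting moves these off the gap. *)
Lemma noncrossing_twist s w : simple s -> invol w -> desc s w -> tight w ->
  noncrossing (twist s w) s.
Proof.
move=> hs iw; have [hw wV] := iw; move=> ds [nn nl].
have sK := simpleK hs; have wK := involK iw.
have mono x y := @simple_mono _ s x y hs.
have gap b z := @simple_gap s b z hs.
have dE b : v b < v (s b) -> v (w (s b)) < v (w b).
  move=> hb; move: ds; rewrite /desc (invertsE _ _ hb) ?gen_signed ?simple_reflection //.
  by rewrite wV.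
have nn' x y : v x < v y -> v y < v (w y) -> v (w y) < v (w x) -> False.
  by move=> h1 h2 h3; apply: nn; exists x, y.
have nl' x y z : v x < v y -> v y < v z -> v z < v (w x) -> v (w x) < v (w y) -> False.
  by move=> h1 h2 h3 h4; apply: nl; exists x, y, z.
move=> a b hb hab; case: (gap b (twist s w a) hb) => // hg; exfalso.
move: hg; rewrite twistE //; case: eqP => [/(twist_comm hs) cm|ne] hg.
  have cmE x : w (s x) = s (w x) by rewrite -!permM cm.
  (* In the commuting case [w] agrees with [s] on the points that [s] moves: any other image of [c]
     would give two nested arcs. *)
  have wE c : v c < v (s c) -> w c = s c.
    move=> hc; have := dE c hc; rewrite cmE => d.
    have n1 := nn' (s (w c)) (w c); rewrite -cmE !wK cmE in n1.
    have n2 := nn' c (s c); rewrite cmE in n2.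
    have g : v (w c) <= v c \/ v (s c) <= v (w c) by apply: gap.
    have d' : v (s (w c)) < v (s (s (w c))) by rewrite sK.
    have g1 := gap _ c d'; have g2 := gap _ (s c) d'; rewrite sK in g1 g2.
    have ne1 : v (w c) != v c by apply/eqP => /pm_int_inj e; rewrite e in d; lia.
    have ne2 : v (w c) != v (s c) -> v (s (w c)) != v c.
      by rewrite -!pm_eq_v; apply: contra => /eqP e; rewrite -[w c]sK e.
    have ne3 : v (s (w c)) != v (s c) by rewrite -pm_eq_v (inj_eq perm_inj) pm_eq_v.
    apply: pm_int_inj; apply/eqP; case: eqP => // /eqP/[dup]/ne2; lia.
  case: (eqVneq (s a) a) => [ea|na].
    rewrite -cmE ea in hg; have wb := wE b hb.
    have ab : v a != v b by apply/eqP => /pm_int_inj e; rewrite -e ea in hb; lia.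
    have wab : v (w a) != v (s b).
      by rewrite -wb -pm_eq_v (inj_eq perm_inj) pm_eq_v.
    by apply: (nn' a b); rewrite ?wb; lia.
  have wa : w a = s a.
    rewrite pm_eq_v in na; have [lt|lt] : v a < v (s a) \/ v (s a) < v a by lia.
      exact: wE.
    by rewrite -{1}[a]sK cmE wE ?sK // sK.
  by rewrite wa sK in hg; lia.
have e1 : v (w b) != v (s b).
  apply/eqP => /pm_int_inj e; apply: ne; apply: (twist_comm_at hs iw (x := b)).
    by apply: pm_neqE; lia.
  by rewrite e sK -e wK.
have d := dE b hb.
have n1 := nn' (w (s b)) (w b); rewrite !wK in n1.
have n2 := nn' b (s b).
have gbe := gap b (w b) hb; have gbf := gap b (w (s b)) hb.
have e2 : v (w (s b)) != v b.
  by rewrite -pm_eq_v (can2_eq wK wK) eq_sym pm_eq_v.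
case: (eqVneq a b) => [eab|nab].
  rewrite eab in hg.
  have gf : v (w (s b)) < v (s (w (s b))) -> v b <= v (w (s b)) \/ v (s (w (s b))) <= v b by apply: gap.
  have ef : v (w (s b)) = v (s b) -> v (s (w (s b))) = v b by move/pm_int_inj => ->; rewrite sK.
  lia.
have lab : v a < v b by rewrite pm_eq_v in nab; lia.
have nsab : s a != b by apply/eqP => e; rewrite -e sK e in hb; lia.
have lA : v (s a) < v (s b) by apply: mono.
have lA' : v (s a) < v b.
  by move: (gap b (s a) hb); rewrite pm_eq_v in nsab; lia.
have nwA : v (w (s a)) != v b -> v (s (w (s a))) != v (s b).
  by rewrite -!pm_eq_v (inj_eq perm_inj).
case: (eqVneq (w (s a)) b) => [ewA|neA].
  have : w b = s a by rewrite -ewA wK.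
  by move=> e; rewrite e in gbe n1 d; lia.
have hg' : v (s b) < v (s (w (s a))) by have := nwA; rewrite pm_eq_v in neA; lia.
have lwA : v b < v (w (s a)).
  have := mono _ _ hg'; rewrite !sK; apply; apply: pm_neqE; lia.
have swA : v (w (s a)) != v (s b).
  by rewrite -pm_eq_v; apply: contraTneq hg' => ->; rewrite sK; lia.
have gwA := gap b (w (s a)) hb.
have ewb : v (w (s a)) != v (w b) by rewrite -pm_eq_v (inj_eq perm_inj) pm_eq_v; lia.
(* The arc from [s a] passes over both [b] and [s b]. It covers or crosses the arc at [b], or the
   one at [s b] if [b] is fixed: a nesting, or a crossing with the other exchanged point in
   between. *)
have m1 := nn' (s a) b; have m2 := nl' (s a) b (s b).
have m3 := nn' (s a) (w (s b)); have m4 := nl' (w (s b)) (s a) b.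
rewrite !wK in m3 m4.
have efA : v (w (s b)) != v (s a).
  by rewrite -pm_eq_v (can2_eq wK wK) eq_sym pm_eq_v.
lia.
Qed.

(** No arc of [twist s w] crosses the gap, so [s] keeps the order of the points under such an arc,
    and a nesting or loose crossing is carried back to [w]. *)
Lemma tight_twist_down s w : simple s -> invol w -> desc s w -> tight w ->
  tight (twist s w).
Proof.
move=> hs iw ds tw; have nc := noncrossing_twist hs iw ds tw.
case: tw => nn nl; have sK := simpleK hs.
have itw := invol_twist hs iw.
case: (s * w * s =P w) => [e|ne].
  have twE x : twist s w x = s (w x) by rewrite twistE // e eqxx.
  have cm : s * twist s w = twist s w * s.
    have cw := twist_comm hs e; rewrite /twist e eqxx !mulgA cw.
    by [].
  have arc x : v x < v (twist s w x) -> twist s w x = w x.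
    move=> hx; rewrite -[w x]sK -twE -!permM -cm permM.
    by case: (eqVneq (s x) x) => [->//|/(noncrossing_fixed hs itw nc cm)]; move=> h; rewrite h in hx; lia.
  split=> [[x [y [h1 h2 h3]]]|[x [y [z [h1 h2 h3 h4]]]]].
    have ex := arc x; have ey := arc y.
    by apply: nn; exists x, y; rewrite -ex -?ey //; lia.
  have ex := arc x; have ey := arc y.
  by apply: nl; exists x, y, z; rewrite -ex -?ey //; lia.
have twE x : twist s w x = s (w (s x)) by rewrite twistE // (introF eqP ne).
have sT x : w (s x) = s (twist s w x) by rewrite twE sK.
have mono a x y : v a <= v x -> v x < v y -> v y <= v (twist s w a) -> v (s x) < v (s y).
  move=> h1 h2 h3; apply: simple_mono => //; apply/eqP => e.
  by have := nc a x; rewrite e => /(_ h2 h1); lia.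
split=> [[x [y [h1 h2 h3]]]|[x [y [z [h1 h2 h3 h4]]]]].
  by apply: nn; exists (s x), (s y); rewrite !sT; split; apply: (mono x); lia.
apply: nl; exists (s x), (s y), (s z); rewrite !sT; split.
- by apply: (mono x); lia.
- by apply: (mono y); lia.
- by apply: (mono x); lia.
- by apply: (mono y); lia.
Qed.

End Arcs.

(** * Boolean ideals *)

Section BooleanTight.
Import Order.TTheory GRing.Theory Num.Theory GroupScope.
Local Open Scope ring_scope.
Local Open Scope group_scope.
Local Notation v := (@pm_int _).
Variable n : nat.
Implicit Types (x y z p q a b : pm n) (u w s t r : {perm pm n}).
Local Notation S := (gensB n).
Local Notation len := (cox_length S).

(** The least moved point goes up and its preimage lies above it, so inversions exist. One at
    minimal distance is adjacent, since a point in between would form a closer inversion with one of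
    the ends. *)
Lemma exists_adjacent_inversion w : w != 1 ->
  exists p q, adjacent p q /\ v (w q) < v (w p).
Proof.
move=> w1.
pose P (xy : pm n * pm n) := (v xy.1 < v xy.2) && (v (w xy.2) < v (w xy.1)).
have [xy hxy] : exists xy, P xy.
  have [x0 hx0] : exists x, w x != x.
    apply/existsP; apply: contraNT w1 => /existsPn h.
    by apply/eqP/permP => x; rewrite perm1; have := h x; rewrite negbK => /eqP.
  have [x hx xmin] := @Order.TotalTheory.arg_minP _ int _ x0 (fun x => w x != x) (fun x => v x) hx0.
  have fixed y : v y < v x -> w y = y.
    by move=> h; apply/eqP; apply: contraTT h => /xmin; rewrite -leNgt.
  exists (x, w^-1 x); rewrite /P /= permKV.
  have wx : v x < v (w x).
    rewrite lt_neqAle -pm_eq_v eq_sym hx /= leNgt; apply/negP => /fixed.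
    by move/perm_inj => e; rewrite e eqxx in hx.
  rewrite wx andbT lt_neqAle -pm_eq_v; apply/andP; split.
    by apply: contra hx => /eqP {1}->; rewrite permKV.
  rewrite leNgt; apply/negP => lt; have := fixed _ lt; rewrite permKV => e.
  by rewrite -e in lt; lia.
have [[p q] /andP[/= h1 h2] pmin] := @arg_minnP _ xy P (fun xy => `|v xy.2 - v xy.1|%N) hxy.
exists p, q; split=> //; split=> // z.
case: (lerP (v z) (v p)) => [|h3]; [by left | right].
rewrite leNgt; apply/negP => h4.
case: (ltrP (v (w z)) (v (w p))) => h5.
  by have := pmin (p, z); rewrite /P /= h3 h5 => /(_ isT); lia.
have : v (w q) < v (w z) by lia.
by move=> h6; have := pmin (z, q); rewrite /P /= h4 h6 => /(_ isT); lia.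
Qed.

(** Sorting by adjacent exchanges: after exchanging an adjacent inversion, the remaining inversions
    inject into those of [w] other than that pair. *)
Lemma signed_gen w : w \in signed_perms n -> w \in <<S>>.
Proof.
pose I w := [set xy : pm n * pm n | (v xy.1 < v xy.2) && (v (w xy.2) < v (w xy.1))].
have [k] := ubnP #|I w|; elim: k w => // k IH w lt hw.
case: (eqVneq w 1) => [->|w1]; first exact: group1.
have [p [q [h hpq]]] := exists_adjacent_inversion w1.
have hs : simple (refl p q) by exists p, q.
rewrite -(groupMl _ (simple_gen hs)); apply: IH; last first.
  by rewrite (groupM (G := signed_group n)) // refl_signed.
apply: (@leq_ltn_trans #|I w :\ (p, q)|); last first.
  have pqI : (p, q) \in I w by rewrite inE /= hpq h.1.
  by have := cardsD1 (p, q) (I w); rewrite pqI; lia.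
pose f (xy : pm n * pm n) := (refl p q xy.1, refl p q xy.2).
have finj : injective f by case=> [x y] [x' y'] [/perm_inj -> /perm_inj ->].
rewrite -(card_imset _ finj); apply/subset_leq_card/subsetP => _ /imsetP[[x y] + ->].
rewrite !inE /= !permM => /andP[h1 h2]; rewrite h2 andbT.
have h3 : refl p q x != y.
  apply/eqP => e; move: h2; rewrite -e simpleK //.
  have [ex|ex] : x = p \/ x = pm_opp q by apply: (refl_up h.1); rewrite e.
    by rewrite ex reflL; lia.
  rewrite ex -refl_opp reflR !(signed_opp hw) !pm_int_opp; lia.
rewrite (simple_mono hs h1 h3) andbT /f xpair_eqE /=; apply/negP => /andP[/eqP e1 /eqP e2].
have ex : x = q by rewrite -[x](simpleK hs) e1 reflL.
have ey : y = p by rewrite -[y](simpleK hs) e2 reflR.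
by have := h.1; rewrite ex ey in h1; lia.
Qed.

Lemma invol_signedP w : reflect (invol w) (w \in invol_signed n).
Proof.
rewrite inE; apply: (iffP andP) => [[hw ow]|[hw wV]].
  split; first exact: signed_gen.
  apply/eqP; rewrite eq_invg_mul -[w * w]/(w ^+ 2) -order_dvdn.
  by have := order_gt0 w; case: #[w] ow => [|[|[|]]].
split; first exact: gen_signed.
by apply: dvdn_leq => //; rewrite order_dvdn -[w ^+ 2]/(w * w) -eq_invg_mul wV.
Qed.

Lemma invol_idealP w u : reflect (invol u /\ leB u w) (u \in invol_ideal w).
Proof.
by rewrite inE; apply: (iffP andP) => -[h1 h2]; split=> //; apply/invol_signedP.
Qed.

Lemma simple_neq1 s : simple s -> s != 1.
Proof.
move=> hs; apply/eqP => e; have [x] := reflection_up (simple_reflection hs).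
by rewrite e perm1; lia.
Qed.

Lemma leB_anti u w : leB u w -> leB w u -> u = w.
Proof.
case/connectP=> [[|a c]] /= + ->; first by [].
case/andP=> st hc h; have lt : (len u < len a)%N by case/andP: st.
have : leB a (last a c) by apply/connectP; exists c.
move=> /leB_cox_length h1; have := leB_cox_length h => h2.
by have := leq_trans lt (leq_trans h1 h2); rewrite ltnn.
Qed.

Definition same_support u u' := forall r, simple r -> leB r u <-> leB r u'.

(** The consequence of being Boolean that drives the induction: it passes at once to every
    involution below [w]. *)
Definition support_separated w := forall u u',
  invol u -> leB u w -> invol u' -> leB u' w -> same_support u u' -> u = u'.

(** An involution other than 1 lies above each of its descents, so the atoms of the ideal are
    generators; and an element of a Boolean lattice is determined by the atoms below it. *)
Lemma boolean_support_separated w : boolean_invol w -> support_separated w.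
Proof.
case=> k [f [[g fK gK] fE]].
pose I := {u | u \in invol_ideal w}.
have fleB U U' : f U \subset f U' -> leB (val U) (val U') by rewrite fE.
have sub u u' (hu : u \in invol_ideal w) (hu' : u' \in invol_ideal w) :
    (forall r, simple r -> leB r u -> leB r u') -> f (Sub u hu) \subset f (Sub u' hu').
  move=> h; apply/subsetP => i hi.
  pose a := g [set i]; have fa : f a = [set i] by rewrite gK.
  have leau : leB (val a) u by rewrite -[u]/(val (Sub u hu : I)); apply: fleB; rewrite fa sub1set.
  have [[aG _] law] := invol_idealP _ _ (valP a).
  have a1 : val a != 1.
    apply/eqP => e; have h0 : leB (val a) (val (g set0)).
      rewrite e; apply: leB1; by have [[]] := invol_idealP _ _ (valP (g set0)).
    by move: h0; rewrite -fE fa gK sub1set inE.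
  have [s [hs ds]] := exists_desc aG a1; have lsa := desc_le hs aG ds.
  have hsw : s \in invol_ideal w.
    by apply/invol_idealP; split; [apply: invol_simple | apply: leB_trans lsa law].
  have fs : f (Sub s hsw) \subset [set i] by rewrite -fa fE.
  have fs' : f (Sub s hsw) = [set i].
    have : f (Sub s hsw) != set0.
      apply: contraNneq (simple_neq1 hs) => e; apply/eqP/leB_1.
      have h1 : 1 \in invol_ideal w.
        by apply/invol_idealP; split; [apply: invol1 | apply: leB_trans law; apply: leB1].
      by rewrite -[s]/(val (Sub s hsw : I)) -[1]/(val (Sub 1 h1 : I)) -fE e sub0set.
    by move: fs; rewrite subset1 => /orP[/eqP->|/eqP->] //; rewrite eqxx.
  have lsu : leB s u by apply: leB_trans lsa leau.
  have := h s hs lsu.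
  by rewrite -[s]/(val (Sub s hsw : I)) -[u']/(val (Sub u' hu' : I)) -fE fs' sub1set.
move=> u u' iu lu iu' lu' h.
have hu : u \in invol_ideal w by apply/invol_idealP.
have hu' : u' \in invol_ideal w by apply/invol_idealP.
have e : f (Sub u hu) = f (Sub u' hu').
  by apply/eqP; rewrite eqEsubset !sub // => r hr; rewrite h.
by have := congr1 g e; rewrite !fK => /(congr1 val).
Qed.

Lemma tight1 : tight (1 : {perm pm n}).
Proof.
by split=> [[x [y]]|[x [y [z]]]]; rewrite !perm1; case; lia.
Qed.

Lemma support_separated_tight w : invol w -> support_separated w -> tight w.
Proof.
have [k] := ubnP (len w); elim: k w => // k IH w lt iw sep.
case: (eqVneq w 1) => [->|w1]; first exact: tight1.
have [s [hs ds]] := exists_desc iw.1 w1.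
have itw := invol_twist hs iw; have ltw := twist_le hs iw ds.
have ndt : ~~ desc s (twist s w) by rewrite desc_twist // ds.
have lt' := cox_length_twist hs iw ds.
have tt : tight (twist s w).
  apply: IH => //; first lia.
  by move=> u u' iu lu iu' lu'; apply: sep => //; apply: leB_trans ltw.
have ns : ~~ leB s (twist s w).
  apply/negP => h; have := twist_neq hs iw; rewrite (sep (twist s w) w) ?eqxx //; first exact: leB_refl.
  move=> r hr; split=> [/leB_trans|]; first exact.
  case: (eqVneq r s) => [-> //|nrs]; rewrite -{1}(twistK w hs).
  exact: supp_twist.
rewrite -(twistK w hs); apply: tight_twist_up => //.
have [p [q [h sE]]] := hs; rewrite sE; apply: crosses_noncrossing => //; rewrite -?sE //.
by move/(leB_crosses h itw.1); rewrite -sE (negbTE ns).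
Qed.

(** Taking supports is an isomorphism onto the subsets of the generators below [w], split into order
    reflection and surjectivity so that each half passes through the induction. *)
Definition boolean_support w :=
  (forall u u', invol u -> leB u w -> invol u' -> leB u' w ->
    (forall r, simple r -> leB r u -> leB r u') -> leB u u') /\
  (forall A : {set {perm pm n}}, (forall r, r \in A -> simple r /\ leB r w) ->
    exists u, [/\ invol u, leB u w & forall r, simple r -> leB r u = (r \in A)]).

Lemma tight_boolean_support w : invol w -> tight w -> boolean_support w.
Proof.
have [k] := ubnP (len w); elim: k w => // k IH w lt iw tw.
case: (eqVneq w 1) => [->|w1].
  split=> [u u' _ /leB_1 -> _ /leB_1 -> _|A hA]; first exact: leB_refl.
  exists 1; split=> [||r hr]; [exact: invol1 | exact: leB_refl | apply/idP/idP].
    by move/leB_1 => e; have := simple_neq1 hr; rewrite e eqxx.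
  by case/hA.
have [s [hs ds]] := exists_desc iw.1 w1.
have itw := invol_twist hs iw; have ltw := twist_le hs iw ds.
have ndt : desc s (twist s w) = false by rewrite desc_twist // ds.
have lt' := cox_length_twist hs iw ds.
have [IH1 IH2] : boolean_support (twist s w).
  by apply: IH => //; [lia | apply: tight_twist_down].
have ns : ~~ leB s (twist s w).
  have [p [q [h sE]]] := hs; apply/negP; rewrite sE => /(leB_crosses h); rewrite -{1}sE => /(_ itw.1).
  by apply: noncrossing_crosses => //; rewrite -sE; apply: noncrossing_twist.
have lower u : invol u -> leB u w -> leB (if desc s u then twist s u else u) (twist s w).
  by move=> iu /(leB_dn hs iu.1); rewrite !dnE // ds.
have raise u : invol u -> leB u (twist s w) -> leB (twist s u) w.
  move=> iu lu; have := leB_up hs iu.1 lu; rewrite !upE // ndt twistK //.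
  case: ifP => // du _; case/negP: ns; apply: leB_trans lu; exact: (desc_le hs iu.1).
(* Without the descent [s], the involution [u] would already lie below [twist s w], which is not
   above [s]. *)
have descP u : invol u -> leB u w -> leB s u = desc s u.
  move=> iu lu; apply/idP/idP; last exact: (desc_le hs iu.1).
  apply: contraTT => nd; have := lower u iu lu; rewrite (negbTE nd) => h.
  by apply: contra ns => /leB_trans; apply.
have supp u r : invol u -> simple r -> r != s -> desc s u -> leB r u -> leB r (twist s u).
  move=> iu hr nrs du h; apply: (supp_twist hr hs nrs (invol_twist hs iu)); last by rewrite twistK.
  by rewrite desc_twist // du.
split=> [u u' iu lu iu' lu' h|A hA].
  have l1 := lower u iu lu; have l2 := lower u' iu' lu'.
  have ne r u0 : leB r u0 -> leB u0 (twist s w) -> r != s.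
    by move=> h1 h2; apply: contraNneq ns => e; rewrite e in h1; apply: leB_trans h2.
  case: (boolP (desc s u)) l1 => du l1.
    have du' : desc s u' by rewrite -descP // h // descP.
    rewrite du' in l2.
    have it := invol_twist hs iu; have it' := invol_twist hs iu'.
    have : leB (twist s u) (twist s u').
      apply: IH1 => // r hr hru; apply: supp => //; first exact: ne hru l1.
      by apply: h => //; apply: leB_trans hru _; apply: twist_le.
    by move/(leB_up hs it.1); rewrite !upE // !desc_twist // du du' /= !twistK.
  case: (boolP (desc s u')) l2 => du' l2; last exact: IH1.
  (* As [s] is not below [u], dropping it from the support of [u'] still leaves the support of [u]
     inside. *)
  apply: leB_trans (twist_le hs iu' du'); apply: IH1 => //; first exact: invol_twist.
  by move=> r hr hru; apply: supp => //; [apply: ne hru l1 | apply: h].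
case: (boolP (s \in A)) => sA; last first.
  have [r hr|u [iu lu hu]] := IH2 A; last by exists u; split=> //; apply: leB_trans ltw.
  have [sr lr] := hA r hr; split=> //; rewrite -/(twist _ _).
  by apply: supp => //; apply: contraTneq hr => ->.
(* A set containing [s] is realised by realising the rest below [twist s w] and twisting upwards. *)
have [r|u [iu lu hu]] := IH2 (A :\ s).
  rewrite !inE => /andP[nrs hr]; have [sr lr] := hA r hr; split=> //.
  exact: supp.
have du : desc s u = false.
  by apply/negbTE; apply: contra ns => /(desc_le hs iu.1) /leB_trans; apply.
have it := invol_twist hs iu; have dt : desc s (twist s u) by rewrite desc_twist // du.
exists (twist s u); split=> // [|r hr]; first exact: raise.
case: (eqVneq r s) => [->|nrs]; first by rewrite sA; apply: (desc_le hs it.1).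
have -> : (r \in A) = (r \in A :\ s) by rewrite !inE nrs.
rewrite -hu //; apply/idP/idP => [|hru].
  by apply: supp_twist; rewrite ?du.
by apply: leB_trans hru _; apply: le_twist; rewrite ?du.
Qed.

Lemma boolean_support_boolean w : invol w -> boolean_support w -> boolean_invol w.
Proof.
move=> iw [h1 h2]; pose K := [set r in S | leB r w].
pose f (U : {u | u \in invol_ideal w}) := [set i : 'I_#|K| | leB (enum_val i) (val U)].
have hK (i : 'I_#|K|) : simple (enum_val i) /\ leB (enum_val i) w.
  by have := enum_valP i; rewrite inE => /andP[/simpleP].
have fE U U' : (f U \subset f U') = leB (val U) (val U').
  have [iu lu] := invol_idealP _ _ (valP U); have [iu' lu'] := invol_idealP _ _ (valP U').
  apply/subsetP/idP => [h|l i]; last by rewrite !inE => /leB_trans; apply.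
  apply: h1 => // r hr lru.
  have rK : r \in K by rewrite inE; apply/andP; split; [apply/simpleP | apply: leB_trans lu].
  by have := h (enum_rank_in rK r); rewrite !inE enum_rankK_in //; apply.
have finj : injective f.
  move=> U U' e; apply: val_inj; apply: leB_anti; by rewrite -fE e.
have fsurj X : exists U, f U == X.
  have [r /imsetP[i hi ->]|u [iu lu hu]] := h2 [set enum_val i | i in X]; first exact: hK.
  have hw : u \in invol_ideal w by apply/invol_idealP.
  exists (Sub u hw); apply/eqP/setP => i; rewrite inE /= hu; last by have [] := hK i.
  by rewrite (mem_imset _ _ enum_val_inj).
exists #|K|, f; split=> //.
have gK X : f (xchoose (fsurj X)) = X by apply/eqP/(xchooseP (fsurj X)).
by exists (fun X => xchoose (fsurj X)) => // U; apply: finj; rewrite gK.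
Qed.

Lemma boolean_tight w : w \in invol_signed n -> boolean_invol w <-> tight w.
Proof.
move/invol_signedP => iw; split=> [/boolean_support_separated|/(tight_boolean_support iw)].
  exact: support_separated_tight.
exact: boolean_support_boolean.
Qed.

End BooleanTight.

(** * Patterns *)

(** Grouped by origin: five traces of 4321, then five of 45312, then six of 456123. *)
Definition boolean_patterns : seq (seq int) :=
  [:: [:: 4; 3; 2; 1];
      [:: -1; -2];
      [:: 2; 1; -3];
      [:: 3; -4; 1; -2];
      [:: -4; 3; 2; -1];
      [:: 4; 5; 3; 1; 2];
      [:: 1; -3; -2];
      [:: 4; 2; -3; 1];
      [:: -4; 5; 3; -1; 2];
      [:: 5; -4; 3; -2; 1];
      [:: 4; 5; 6; 1; 2; 3];
      [:: -3; -2; -1];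
      [:: 4; -3; -2; 1];
      [:: 4; 5; -3; 1; 2];
      [:: -4; 5; 6; -1; 2; 3];
      [:: 5; -4; 6; -2; 1; 3]]%Z.

(** Signs and comparisons of absolute values, which are what containment records, determine the
    order. Both strict comparisons appear so that equality of absolute values transfers too. *)
Lemma sgz_absz_mono (e e' : bool) (P Q X Y : int) :
  sgz X = sgz P -> sgz Y = sgz Q ->
  (`|X| < `|Y|)%N = (`|P| < `|Q|)%N -> (`|Y| < `|X|)%N = (`|Q| < `|P|)%N ->
  ((if e then - P else P) < (if e' then - Q else Q))%R ->
  ((if e then - X else X) < (if e' then - Y else Y))%R.
Proof. by case: e e' => [] []; lia. Qed.

Section Patterns.
Import Order.TTheory GRing.Theory Num.Theory.
Local Open Scope ring_scope.
Local Notation v := (@pm_int _).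
Variables (n : nat) (w : {perm pm n}).
Hypotheses (wS : {morph w : x / pm_opp x}) (wK : involutive w).
Implicit Types (x y z a b : pm n).

(** If [w] raises [x2], the arcs from [x1] and [x2] are nested; otherwise [w] lowers [x3], and the
    arcs ending at [x4] and [x3] are. *)
Lemma decreasing4_nested x1 x2 x3 x4 :
  v x1 < v x2 -> v x2 < v x3 -> v x3 < v x4 ->
  v (w x4) < v (w x3) -> v (w x3) < v (w x2) -> v (w x2) < v (w x1) -> nested w.
Proof.
move=> h1 h2 h3 h4 h5 h6; case: (ltrP (v x2) (v (w x2))) => h.
  by exists x1, x2.
by exists (w x4), (w x3); rewrite !wK; split; lia.
Qed.

(** If [w] does not lower [x3], this point lies between [x2] and [w x1]; otherwise it lies between
    [w x5] and [x4]. *)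
Lemma pattern45312_loose x1 x2 x3 x4 x5 :
  v x1 < v x2 -> v x2 < v x3 -> v x3 < v x4 -> v x4 < v x5 ->
  v (w x4) < v (w x5) -> v (w x5) < v (w x3) -> v (w x3) < v (w x1) ->
  v (w x1) < v (w x2) -> loose w.
Proof.
move=> h1 h2 h3 h4 h5 h6 h7 h8; case: (lerP (v x3) (v (w x3))) => h.
  by exists x1, x2, x3; split; lia.
by exists (w x4), (w x5), x3; rewrite !wK; split; lia.
Qed.

(** Either [x3] lies below [w x1], inside the crossing of the first two arcs, or [w x6] lies below
    [x4], inside the crossing of the arcs ending at [x4] and [x5]. *)
Lemma pattern456123_loose x1 x2 x3 x4 x5 x6 :
  v x1 < v x2 -> v x2 < v x3 -> v x3 < v x4 -> v x4 < v x5 -> v x5 < v x6 ->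
  v (w x4) < v (w x5) -> v (w x5) < v (w x6) -> v (w x6) < v (w x1) ->
  v (w x1) < v (w x2) -> v (w x2) < v (w x3) -> loose w.
Proof.
move=> h1 h2 h3 h4 h5 h6 h7 h8 h9 h10; case: (ltrP (v x3) (v (w x1))) => h.
  by exists x1, x2, x3.
by exists (w x4), (w x5), (w x6); rewrite !wK; split; lia.
Qed.

(** * From pattern occurrences to configurations of arcs in [±n] *)

Section ContainsTight.
Variables (p : seq int) (f : 'I_(size p) -> 'I_n).
Hypotheses (fpos : {homo f : j k / (j < k)%N})
  (fabs : forall j k, (`|window w (f j)| < `|window w (f k)|)%N
                    = (`|nth 0%R p j| < `|nth 0%R p k|)%N)
  (fsgn : forall j, sgz (window w (f j)) = sgz (nth 0 p j)).

(* [f] extended to an odd map on the points of [±m], [m] the size of the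
   pattern [p], and the odd extension of [p] itself. *)
Definition full_point (x : pm (size p)) : pm n := (x.1, f x.2).
Definition full_pattern (x : pm (size p)) : int :=
  if x.1 then - nth 0 p x.2 else nth 0 p x.2.

Lemma full_point_mono (x y : pm (size p)) : v x < v y -> v (full_point x) < v (full_point y).
Proof.
case: x y => [b j] [c k]; rewrite /full_point /pm_int /=.
have h1 := fpos (x := j) (y := k); have h2 := fpos (x := k) (y := j).
by case: b c => [] [] /=; lia.
Qed.

Lemma full_pattern_mono (x y : pm (size p)) : full_pattern x < full_pattern y ->
  v (w (full_point x)) < v (w (full_point y)).
Proof.
have wE (e : bool) i : v (w (e, i)) = if e then - window w i else window w i.
  by case: e => //; rewrite -[(true, i)]/(pm_opp (pm_pos i)) wS pm_int_opp.
case: x y => [b j] [c k]; rewrite /full_point /full_pattern /= !wE.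
exact: sgz_absz_mono.
Qed.

End ContainsTight.

Lemma contains_decreasing4 p (h : contains w p) (x1 x2 x3 x4 : pm (size p)) :
  v x1 < v x2 -> v x2 < v x3 -> v x3 < v x4 ->
  full_pattern x4 < full_pattern x3 -> full_pattern x3 < full_pattern x2 ->
  full_pattern x2 < full_pattern x1 -> nested w.
Proof.
case: h => f [fpos fabs fsgn].
have hx := @full_point_mono _ _ fpos; have hy := @full_pattern_mono _ _ fabs fsgn.
move=> /hx h1 /hx h2 /hx h3 /hy h4 /hy h5 /hy h6.
exact: decreasing4_nested h1 h2 h3 h4 h5 h6.
Qed.

Lemma contains_45312 p (h : contains w p) (x1 x2 x3 x4 x5 : pm (size p)) :
  v x1 < v x2 -> v x2 < v x3 -> v x3 < v x4 -> v x4 < v x5 ->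
  full_pattern x4 < full_pattern x5 -> full_pattern x5 < full_pattern x3 ->
  full_pattern x3 < full_pattern x1 -> full_pattern x1 < full_pattern x2 -> loose w.
Proof.
case: h => f [fpos fabs fsgn].
have hx := @full_point_mono _ _ fpos; have hy := @full_pattern_mono _ _ fabs fsgn.
move=> /hx h1 /hx h2 /hx h3 /hx h4 /hy h5 /hy h6 /hy h7 /hy h8.
exact: pattern45312_loose h1 h2 h3 h4 h5 h6 h7 h8.
Qed.

Lemma contains_456123 p (h : contains w p) (x1 x2 x3 x4 x5 x6 : pm (size p)) :
  v x1 < v x2 -> v x2 < v x3 -> v x3 < v x4 -> v x4 < v x5 -> v x5 < v x6 ->
  full_pattern x4 < full_pattern x5 -> full_pattern x5 < full_pattern x6 ->
  full_pattern x6 < full_pattern x1 -> full_pattern x1 < full_pattern x2 ->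
  full_pattern x2 < full_pattern x3 -> loose w.
Proof.
case: h => f [fpos fabs fsgn].
have hx := @full_point_mono _ _ fpos; have hy := @full_pattern_mono _ _ fabs fsgn.
move=> /hx h1 /hx h2 /hx h3 /hx h4 /hx h5 /hy h6 /hy h7 /hy h8 /hy h9 /hy h10.
exact: pattern456123_loose h1 h2 h3 h4 h5 h6 h7 h8 h9 h10.
Qed.

Local Notation pos m k := ((false, @Ordinal m k isT) : pm m).
Local Notation neg m k := ((true, @Ordinal m k isT) : pm m).

Lemma tight_avoids p : tight w -> p \in boolean_patterns -> avoids w p.
Proof.
move=> [nn nl]; rewrite /boolean_patterns !in_cons in_nil orbF.
repeat case/orP; move/eqP => -> h.
(* Each line locates 4321, 45312 or 456123 in the odd extension of the pattern, with positions
   counted from 0. *)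
- by apply: nn; apply: (@contains_decreasing4 _ h (pos 4 0) (pos 4 1) (pos 4 2) (pos 4 3)).
- by apply: nn; apply: (@contains_decreasing4 _ h (neg 2 1) (neg 2 0) (pos 2 0) (pos 2 1)).
- by apply: nn; apply: (@contains_decreasing4 _ h (neg 3 2) (pos 3 0) (pos 3 1) (pos 3 2)).
- by apply: nn; apply: (@contains_decreasing4 _ h (neg 4 1) (pos 4 0) (pos 4 2) (pos 4 3)).
- by apply: nn; apply: (@contains_decreasing4 _ h (neg 4 0) (pos 4 1) (pos 4 2) (pos 4 3)).
- by apply: nl; apply: (@contains_45312 _ h (pos 5 0) (pos 5 1) (pos 5 2) (pos 5 3) (pos 5 4)).
- by apply: nl; apply: (@contains_45312 _ h (neg 3 2) (neg 3 1) (pos 3 0) (pos 3 1) (pos 3 2)).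
- by apply: nl; apply: (@contains_45312 _ h (neg 4 2) (pos 4 0) (pos 4 1) (pos 4 2) (pos 4 3)).
- by apply: nl; apply: (@contains_45312 _ h (neg 5 0) (pos 5 1) (pos 5 2) (pos 5 3) (pos 5 4)).
- by apply: nl; apply: (@contains_45312 _ h (neg 5 1) (pos 5 0) (pos 5 2) (pos 5 3) (pos 5 4)).
- by apply: nl; apply: (@contains_456123 _ h (pos 6 0) (pos 6 1) (pos 6 2) (pos 6 3) (pos 6 4) (pos 6 5)).
- by apply: nl; apply: (@contains_456123 _ h (neg 3 2) (neg 3 1) (neg 3 0) (pos 3 0) (pos 3 1) (pos 3 2)).
- by apply: nl; apply: (@contains_456123 _ h (neg 4 2) (neg 4 1) (pos 4 0) (pos 4 1) (pos 4 2) (pos 4 3)).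
- by apply: nl; apply: (@contains_456123 _ h (neg 5 2) (pos 5 0) (pos 5 1) (pos 5 2) (pos 5 3) (pos 5 4)).
- by apply: nl; apply: (@contains_456123 _ h (neg 6 0) (pos 6 1) (pos 6 2) (pos 6 3) (pos 6 4) (pos 6 5)).
- by apply: nl; apply: (@contains_456123 _ h (neg 6 1) (pos 6 0) (pos 6 2) (pos 6 3) (pos 6 4) (pos 6 5)).
Qed.

(* The points of [s] are the positions of an occurrence of the pattern coded by
   [q], and [u] lists the absolute values in increasing order; the pair [(e, k)]
   codes the entry [k + 1], negated if [e] holds. *)
Definition decode (ek : bool * nat) : int :=
  if ek.1 then - (ek.2.+1)%:Z else (ek.2.+1)%:Z.

Lemma decodeE ek : decode ek = if ek.1 then - (ek.2.+1)%:Z else (ek.2.+1)%:Z.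
Proof. by []. Qed.

(** Starting both paths at 0 makes the points and the absolute values positive, so the points of [s]
    are window positions. *)
Lemma contains_intro (p : seq int) q (s : seq (pm n)) (u : seq int) :
  p = map decode q -> size s = size q ->
  all (fun ek => (ek.2 < size u)%N) q ->
  path <%R 0 (map v s) -> path <%R 0 u ->
  all2 (fun x ek => v (w x) == if ek.1 then - nth 0 u ek.2 else nth 0 u ek.2) s q ->
  contains w p.
Proof.
move=> -> hs hq ps pu hw.
have ess : size s = size (map decode q) by rewrite size_map.
pose x j := tnth (in_tuple s) (cast_ord (esym ess) j).
have xE j x0 : x j = nth x0 s j by rewrite /x (tnth_nth x0).
have xpos j : 0 < v (x j).
  move: ps; rewrite (path_sortedE lt_trans) => /andP[/allP h _]; apply: h.
  by apply: map_f; rewrite /x mem_tnth.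
have xwin j : window w (x j).2 = v (w (x j)).
  have := xpos j; rewrite /window; case: (x j) => [[] i] //=.
have upos k : (k < size u)%N -> 0 < nth 0 u k.
  move: pu; rewrite (path_sortedE lt_trans) => /andP[/allP h _] lt; apply: h.
  exact: mem_nth.
have umono k l : (k < size u)%N -> (l < size u)%N -> (nth 0 u k < nth 0 u l) = (k < l)%N.
  move=> hk hl; apply: (lt_sorted_ltn_nth 0); rewrite ?inE //.
  exact: path_sorted pu.
pose e j := nth (false, 0%N) q j.
have eq j : (j < size q)%N -> ((e j).2 < size u)%N.
  by move=> hj; move/all_nthP: hq => /(_ (false, 0%N) j hj).
have wx (j : 'I_(size (map decode q))) : v (w (x j)) =
    if (e j).1 then - nth 0 u (e j).2 else nth 0 u (e j).2.
  move: hw; rewrite all2E => /andP[_ /(all_nthP (x j, (false, 0%N)))].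
  have jq : (j < size q)%N by rewrite -(size_map decode q) ltn_ord.
  move=> /(_ j); rewrite size_zip hs minnn => /(_ jq).
  by rewrite nth_zip // -xE => /eqP.
have pE (j : 'I_(size (map decode q))) : nth 0 (map decode q) j = decode (e j).
  by rewrite (nth_map (false, 0%N)) // -(size_map decode q) ltn_ord.
have jq (j : 'I_(size (map decode q))) : (j < size q)%N.
  by rewrite -(size_map decode q) ltn_ord.
exists (fun j => (x j).2); split=> [j k jk|j k|j].
- have : v (x j) < v (x k).
    have vxE i : v (x i) = nth 0 (map v s) i.
      by rewrite (nth_map (x i)) ?hs ?jq //; congr pm_int; apply: xE.
    have inS (i : 'I_(size (map decode q))) : (i : nat) \in [pred m | m < size (map v s)]%N.
      by rewrite inE (size_map (@pm_int n) s) hs jq.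
    by rewrite !vxE (lt_sorted_ltn_nth 0 (path_sorted ps) (inS _) (inS _)).
  have := xpos j; have := xpos k; rewrite /pm_int.
  by case: (x j) (x k) => [[] a] [[] b] /=; lia.
- rewrite !xwin !wx !pE !decodeE.
  have := upos _ (eq _ (jq j)); have := upos _ (eq _ (jq k)).
  have := umono _ _ (eq _ (jq j)) (eq _ (jq k)).
  by case: (e j).1 (e k).1 => [] []; lia.
- rewrite !xwin !wx !pE !decodeE; have := upos _ (eq _ (jq j)).
  case: (e j).1 => h; last by rewrite !gtr0_sgz.
  by rewrite !sgzN !gtr0_sgz.
Qed.

(** * From avoidance to tightness *)

Section AvoidsTight.
Hypothesis av : forall p, p \in boolean_patterns -> avoids w p.

Lemma no_occurrence q (s : seq (pm n)) (u : seq int) :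
  map decode q \in boolean_patterns -> size s = size q ->
  all (fun ek => (ek.2 < size u)%N) q ->
  path <%R 0 (map v s) -> path <%R 0 u ->
  all2 (fun x ek => v (w x) == if ek.1 then - nth 0 u ek.2 else nth 0 u ek.2) s q ->
  False.
Proof. by move=> hq h1 h2 h3 h4 h5; apply: (av hq); apply: contains_intro h5. Qed.

Let w_opp x : v (w (pm_opp x)) = - v (w x).
Proof. by rewrite wS pm_int_opp. Qed.

Let w_congr x y : v x = v y -> v (w x) = v (w y).
Proof. by move/pm_int_inj ->. Qed.

(** Negation allows the right end of the inner arc to be taken positive. The signs of [a] and [b],
    and the place of the opposite of [a] relative to [b] and [c], then decide which pattern
    occurs. *)
Lemma avoids_not_nested : ~ nested w.
Proof.
suff H a b c d : v a < v b -> v b < v c -> v c < v d -> w a = d -> w b = c ->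
    0 < v c -> False.
  move=> [x [y [h1 h2 h3]]]; case: (ltrP 0 (v (w y))) => h.
    exact: (H x y (w y) (w x)).
  apply: (H (pm_opp (w x)) (pm_opp (w y)) (pm_opp y) (pm_opp x));
    by rewrite ?wS ?wK ?pm_int_opp //; have := pm_int_neq0 (w y); lia.
move=> h1 h2 h3 ad bc c0.
have da : w d = a by rewrite -ad wK.
have cb : w c = b by rewrite -bc wK.
have := w_opp a; have := w_opp b; rewrite ad bc => bc' ad'.
have vA := pm_int_opp a; have vB := pm_int_opp b.
have a0 := pm_int_neq0 a; have b0 := pm_int_neq0 b.
(* For positive [b], the opposite of [a] is neither [b] nor [c]: its image is negative and theirs
   are positive. *)
have Ab := w_congr (x := pm_opp a) (y := b); have Ac := w_congr (x := pm_opp a) (y := c).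
rewrite bc in Ab; rewrite cb in Ac.
case: (ltrP 0 (v a)) => a0'.
  by apply: (@no_occurrence [:: (false, 3); (false, 2); (false, 1); (false, 0)]%N
    [:: a; b; c; d] [:: v a; v b; v c; v d]) => //=; rewrite ?ad ?bc ?cb ?da; lia.
case: (ltrP 0 (v b)) => b0'; last first.
  by apply: (@no_occurrence [:: (true, 0); (true, 1)]%N
    [:: pm_opp b; pm_opp a] [:: v c; v d]) => //=; lia.
case: (ltrP (v (pm_opp a)) (v b)) => hAb.
  by apply: (@no_occurrence [:: (true, 3); (false, 2); (false, 1); (true, 0)]%N
    [:: pm_opp a; b; c; d] [:: v (pm_opp a); v b; v c; v d]) => //=;
    rewrite ?ad ?bc ?cb ?da; lia.
case: (ltrP (v (pm_opp a)) (v c)) => hAc.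
  by apply: (@no_occurrence [:: (false, 2); (true, 3); (false, 0); (true, 1)]%N
    [:: b; pm_opp a; c; d] [:: v b; v (pm_opp a); v c; v d]) => //=;
    rewrite ?ad ?bc ?cb ?da; lia.
by apply: (@no_occurrence [:: (false, 1); (false, 0); (true, 2)]%N
  [:: b; c; pm_opp a] [:: v b; v c; v d]) => //=; rewrite ?ad ?bc ?cb ?da; lia.
Qed.

Let not_nested x y : v x < v y -> v y < v (w y) -> v (w y) < v (w x) -> False.
Proof. by move=> h1 h2 h3; apply: avoids_not_nested; exists x, y. Qed.

(** Here [a b z c d] form 45312 in [±n]; the signs of [a] and [b] and the places of their opposites
    decide which signed pattern appears. *)
Lemma avoids_no_fixed_between a b z c d :
  v a < v b -> v b < v z -> v z < v c -> v c < v d ->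
  w a = c -> w b = d -> w z = z -> 0 < v z -> False.
Proof.
move=> h1 h2 h3 h4 ac bd zz z0.
have ca : w c = a by rewrite -ac wK.
have db : w d = b by rewrite -bd wK.
have := w_opp a; have := w_opp b; rewrite ac bd => bd' ac'.
have vA := pm_int_opp a; have vB := pm_int_opp b.
have a0 := pm_int_neq0 a; have b0 := pm_int_neq0 b.
have Ab := w_congr (x := pm_opp a) (y := b); have Az := w_congr (x := pm_opp a) (y := z).
have Ad := w_congr (x := pm_opp a) (y := d); have Bz := w_congr (x := pm_opp b) (y := z).
rewrite bd in Ab; rewrite zz in Az Bz; rewrite db in Ad.
case: (ltrP 0 (v a)) => a0'.
  by apply: (@no_occurrence [:: (false, 3); (false, 4); (false, 2); (false, 0); (false, 1)]%N
    [:: a; b; z; c; d] [:: v a; v b; v z; v c; v d]) => //=;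
    rewrite ?ac ?bd ?zz ?ca ?db; lia.
case: (ltrP 0 (v b)) => b0'.
  case: (ltrP (v (pm_opp a)) (v b)) => hAb.
    by apply: (@no_occurrence [:: (true, 3); (false, 4); (false, 2); (true, 0); (false, 1)]%N
      [:: pm_opp a; b; z; c; d] [:: v (pm_opp a); v b; v z; v c; v d]) => //=;
      rewrite ?ac ?bd ?zz ?ca ?db; lia.
  case: (ltrP (v (pm_opp a)) (v z)) => hAz.
    by apply: (@no_occurrence [:: (false, 4); (true, 3); (false, 2); (true, 1); (false, 0)]%N
      [:: b; pm_opp a; z; c; d] [:: v b; v (pm_opp a); v z; v c; v d]) => //=;
      rewrite ?ac ?bd ?zz ?ca ?db; lia.
  case: (ltrP (v (pm_opp a)) (v d)) => hAd.
    by apply: (@no_occurrence [:: (false, 3); (false, 1); (true, 2); (false, 0)]%N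
      [:: b; z; c; d] [:: v b; v z; v (pm_opp a); v d]) => //=;
      rewrite ?ac ?bd ?zz ?ca ?db; lia.
  by apply: (@no_occurrence [:: (false, 1); (false, 0); (true, 2)]%N
    [:: z; d; pm_opp a] [:: v b; v z; v c]) => //=;
    rewrite ?ac ?bd ?zz ?ca ?db; lia.
case: (ltrP (v z) (v (pm_opp b))) => hzB.
  by apply: (@no_occurrence [:: (false, 0); (true, 2); (true, 1)]%N
    [:: z; pm_opp b; pm_opp a] [:: v z; v c; v d]) => //=; rewrite ?zz; lia.
case: (ltrP (v (pm_opp a)) (v d)) => hAd.
  by apply: (@no_occurrence [:: (true, 2); (true, 1); (true, 0)]%N
    [:: pm_opp b; c; d] [:: v (pm_opp b); v (pm_opp a); v d]) => //=;
    rewrite ?ca ?db; lia.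
by apply: (@no_occurrence [:: (true, 0); (true, 1)]%N
  [:: pm_opp b; c] [:: v d; v (pm_opp a)]) => //=; rewrite ?ca; lia.
Qed.

(** The six ends form 456123 in [±n], and the cases are split in the same way. Where no pattern
    appears, the arc joining the opposites of [b1] and [a1] covers another arc, against the absence
    of nestings. *)
Lemma avoids_no_triple_crossing a1 a2 a3 b1 b2 b3 :
  v a1 < v a2 -> v a2 < v a3 -> v a3 < v b1 -> v b1 < v b2 -> v b2 < v b3 ->
  w a1 = b1 -> w a2 = b2 -> w a3 = b3 -> 0 < v b1 -> False.
Proof.
move=> h1 h2 h3 h4 h5 e1 e2 e3 b0.
have f1 : w b1 = a1 by rewrite -e1 wK.
have f2 : w b2 = a2 by rewrite -e2 wK.
have f3 : w b3 = a3 by rewrite -e3 wK.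
have := w_opp a1; have := w_opp a2; have := w_opp a3; rewrite e1 e2 e3 => o3 o2 o1.
have v1 := pm_int_opp a1; have v2 := pm_int_opp a2; have v3 := pm_int_opp a3.
have n1 := pm_int_neq0 a1; have n2 := pm_int_neq0 a2; have n3 := pm_int_neq0 a3.
have c1 y := w_congr (x := pm_opp a1) (y := y).
have c2 y := w_congr (x := pm_opp a2) (y := y).
have c1a2 := c1 a2; have c1a3 := c1 a3; have c1b2 := c1 b2; have c1b3 := c1 b3.
have c2a3 := c2 a3; have c2b1 := c2 b1.
rewrite e2 in c1a2; rewrite e3 in c1a3 c2a3; rewrite f2 in c1b2; rewrite f3 in c1b3.
rewrite f1 in c2b1.
have nest x : v (pm_opp b1) < v x -> v x < v (w x) -> v (w x) < v (pm_opp a1) -> False.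
  by move=> g1 g2 g3; apply: not_nested g1 g2 _; rewrite wS f1.
have nb1 := pm_int_opp b1.
case: (ltrP 0 (v a1)) => p1.
  by apply: (@no_occurrence
    [:: (false, 3); (false, 4); (false, 5); (false, 0); (false, 1); (false, 2)]%N
    [:: a1; a2; a3; b1; b2; b3] [:: v a1; v a2; v a3; v b1; v b2; v b3]) => //=;
    rewrite ?e1 ?e2 ?e3 ?f1 ?f2 ?f3; lia.
case: (ltrP 0 (v a2)) => p2.
  case: (ltrP (v (pm_opp a1)) (v a2)) => g1.
    by apply: (@no_occurrence
      [:: (true, 3); (false, 4); (false, 5); (true, 0); (false, 1); (false, 2)]%N
      [:: pm_opp a1; a2; a3; b1; b2; b3]
      [:: v (pm_opp a1); v a2; v a3; v b1; v b2; v b3]) => //=;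
      rewrite ?e1 ?e2 ?e3 ?f1 ?f2 ?f3; lia.
  case: (ltrP (v (pm_opp a1)) (v a3)) => g2.
    by apply: (@no_occurrence
      [:: (false, 4); (true, 3); (false, 5); (true, 1); (false, 0); (false, 2)]%N
      [:: a2; pm_opp a1; a3; b1; b2; b3]
      [:: v a2; v (pm_opp a1); v a3; v b1; v b2; v b3]) => //=;
      rewrite ?e1 ?e2 ?e3 ?f1 ?f2 ?f3; lia.
  case: (ltrP (v (pm_opp a1)) (v b2)) => g3.
    by apply: (@no_occurrence
      [:: (false, 3); (false, 4); (true, 2); (false, 0); (false, 1)]%N
      [:: a2; a3; b1; b2; b3]
      [:: v a2; v a3; v (pm_opp a1); v b2; v b3]) => //=;
      rewrite ?e1 ?e2 ?e3 ?f1 ?f2 ?f3; lia.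
  by apply: (nest a2); rewrite ?e2; lia.
case: (ltrP 0 (v a3)) => p3; last first.
  by apply: (@no_occurrence [:: (true, 2); (true, 1); (true, 0)]%N
    [:: pm_opp a3; pm_opp a2; pm_opp a1] [:: v b1; v b2; v b3]) => //=; lia.
have g0 : v (pm_opp a1) <= v b3.
  by rewrite leNgt; apply/negP => g; apply: (nest a3); rewrite ?e3; lia.
case: (ltrP (v a3) (v (pm_opp a2))) => g1.
  by apply: (@no_occurrence [:: (false, 3); (true, 2); (true, 1); (false, 0)]%N
    [:: a3; pm_opp a2; pm_opp a1; b3] [:: v a3; v b1; v b2; v b3]) => //=;
    rewrite ?e3 ?f3; lia.
case: (ltrP (v (pm_opp a1)) (v b2)) => g2.
  by apply: (@no_occurrence [:: (true, 2); (true, 1); (true, 0)]%N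
    [:: pm_opp a2; b1; b2] [:: v (pm_opp a2); v (pm_opp a1); v b2]) => //=;
    rewrite ?f1 ?f2; lia.
by apply: (@no_occurrence [:: (true, 0); (true, 1)]%N
  [:: pm_opp a2; b1] [:: v b2; v (pm_opp a1)]) => //=; rewrite ?f1; lia.
Qed.

(** A point inside a crossing is fixed, or is the end of an arc which, as nestings are excluded,
    crosses both of the other arcs. *)
Lemma avoids_not_loose : ~ loose w.
Proof.
have fixd a b z c d : v a < v b -> v b < v z -> v z < v c -> v c < v d ->
    w a = c -> w b = d -> w z = z -> False.
  move=> h1 h2 h3 h4 e1 e2 e3; case: (ltrP 0 (v z)) => z0.
    exact: (avoids_no_fixed_between h1 h2 h3 h4).
  (* Negation reverses the order and exchanges left and right ends, which reduces to a positive
     [z]. *)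
  apply: (@avoids_no_fixed_between (pm_opp d) (pm_opp c) (pm_opp z) (pm_opp b) (pm_opp a));
    by rewrite ?pm_int_opp ?wS -?e1 -?e2 ?wK ?e3 //; have := pm_int_neq0 z; rewrite ?e1 ?e2; lia.
have triple a1 a2 a3 : v a1 < v a2 -> v a2 < v a3 -> v a3 < v (w a1) ->
    v (w a1) < v (w a2) -> v (w a2) < v (w a3) -> False.
  move=> h1 h2 h3 h4 h5; case: (ltrP 0 (v (w a1))) => b0.
    exact: (avoids_no_triple_crossing h1 h2 h3 h4 h5).
  apply: (@avoids_no_triple_crossing (pm_opp (w a3)) (pm_opp (w a2)) (pm_opp (w a1))
    (pm_opp a3) (pm_opp a2) (pm_opp a1)); by rewrite ?pm_int_opp ?wS ?wK //; lia.
move=> [x [y [z [h1 h2 h3 h4]]]].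
case: (ltgtP (v (w z)) (v z)) => h; last exact: (fixd x y z (w x) (w y)) (pm_int_inj h).
  have n1 := not_nested (x := x) (y := w z); rewrite wK in n1.
  have ne : v (w z) != v x.
    by apply/eqP => /pm_int_inj e; move: h3; rewrite -e wK; lia.
  by apply: (triple (w z) x y); rewrite ?wK; lia.
have n1 := not_nested (x := y) (y := z).
have ne : v (w z) != v (w y).
  by apply/eqP => /pm_int_inj/perm_inj e; rewrite e in h2; lia.
by apply: (triple x y z); lia.
Qed.

End AvoidsTight.

Lemma avoids_tight : (forall p, p \in boolean_patterns -> avoids w p) -> tight w.
Proof. by move=> av; split; [apply: avoids_not_nested | apply: avoids_not_loose]. Qed.

End Patterns.

Theorem proposition3p14 (n : nat) (w : {perm pm n})
    (hw : w \in invol_signed n) :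
  boolean_invol w <->
  (forall p : seq int,
     p \in ([:: [:: 4; 3; 2; 1];
                [:: -1; -2];
                [:: 2; 1; -3];
                [:: 3; -4; 1; -2];
                [:: -4; 3; 2; -1];
                [:: 4; 5; 3; 1; 2];
                [:: 1; -3; -2];
                [:: 4; 2; -3; 1];
                [:: -4; 5; 3; -1; 2];
                [:: 5; -4; 3; -2; 1];
                [:: 4; 5; 6; 1; 2; 3];
                [:: -3; -2; -1];
                [:: 4; -3; -2; 1];
                [:: 4; 5; -3; 1; 2];
                [:: -4; 5; 6; -1; 2; 3];
                [:: 5; -4; 6; -2; 1; 3]]%Z : seq (seq int)) ->
     avoids w p).
Proof.
have [hG wV] := invol_signedP _ hw.
have wS := signed_opp (gen_signed hG); have wK := involK (conj hG wV).
rewrite boolean_tight //; split=> [tw p hp|av].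
  exact: tight_avoids.
exact: avoids_tight.
Qed.
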